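(* Let $(\mathcal{D},g)$ be a contact sub-pseudo-Riemannian structure on a $(2n+1)$-dimensional manifold $M$. If $h=0$ and $\mathcal{L}_{X_0}\omega=0$, then the projections $\tilde g$ and $\tilde\omega$ of $g$ and $\omega$ to the (local) quotient manifold $N=M/X_0$ determine the structure $(\mathcal{D},g)$ uniquely. That is, if $(M_1,\mathcal{D}_1,g_1)$ and $(M_2,\mathcal{D}_2,g_2)$ are two such structures with $h_a=0$ and $\mathcal{L}_{X_0^{(a)}}\omega_a=0$ for $a=1,2$ (where $X_0^{(a)}$ is the Reeb vector field of the $a$-th structure), and if near points $p_1\in N_1$ and $p_2\in N_2$ there is a local diffeomorphism $\varphi\colon N_1\to N_2$ with $\varphi(p_1)=p_2$, $\varphi^*\tilde g_2=\tilde g_1$ and $\varphi^*\tilde\omega_2=\tilde\omega_1$, then for any $q_1\in M_1$, $q_2\in M_2$ lying over $p_1,p_2$ there is a diffeomorphism $F$ from a neighbourhood of $q_1$ onto a neighbourhood of $q_2$, with $F(q_1)=q_2$, mapping $\mathcal{D}_1$ to $\mathcal{D}_2$ and with $F^*g_2=g_1$ on $\mathcal{D}_1$.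
   Context: All objects are smooth and considerations are local. A contact sub-pseudo-Riemannian structure on a $(2n+1)$-dimensional manifold $M$ is a pair $(\mathcal{D},g)$, where $\mathcal{D}\subset TM$ is a contact distribution (rank $2n$) and $g$ is a pseudo-Riemannian metric on $\mathcal{D}$ of arbitrary signature. $\mathcal{D}$ is assumed oriented. Let $\alpha$ be a one-form annihilating $\mathcal{D}$, normalised by $(d\alpha|_{\mathcal{D}})^{\wedge n}(X_1,\ldots,X_{2n})=(-1)^n$ for positively oriented orthonormal frames $(X_1,\ldots,X_{2n})$ of $\mathcal{D}$ (orthonormal: $g(X_i,X_j)=0$ for $i\neq j$ and $g(X_i,X_i)\in\{-1,1\}$, depending on the signature). The Reeb vector field $X_0$ is defined by $X_0\in\ker d\alpha$, $\alpha(X_0)=1$; its flow preserves $\mathcal{D}$. Put $\omega(X,Y)=-d\alpha(X,Y)$ for sections $X,Y$ of $\mathcal{D}$, and let $h=\frac12\mathcal{L}_{X_0}g$, i.e. $h(X,Y)=\frac12\left(X_0(g(X,Y))-g([X_0,X],Y)-g(X,[X_0,Y])\right)$ on $\mathcal{D}$. $N=M/X_0$ is the (locally defined) $2n$-dimensional manifold of trajectories of $X_0$. If $h=0$, the projection of $g$ is the unique metric $\tilde g$ on $N$ whose pullback to $\mathcal{D}$ coincides with $g$. If $\mathcal{L}_{X_0}\omega=0$, the projection of $\omega$ is the unique 2-form $\tilde\omega$ on $N$ whose pullback to $\mathcal{D}$ coincides with $\omega$. *)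

(* Defs.v *)
From HB Require Import structures.
From mathcomp Require Import all_boot all_order all_algebra all_fingroup.
From mathcomp Require Import all_classical all_reals all_analysis.

Set Implicit Arguments.
Unset Strict Implicit.
Unset Printing Implicit Defensive.

Import Order.TTheory GRing.Theory Num.Theory.
Import numFieldNormedType.Exports.

Local Open Scope classical_set_scope.
Local Open Scope ring_scope.

(** * Smooth functions between (finite-dimensional) normed spaces *)

(* The set A is always open below, so only the germ of f at points of A
   matters. *)
Fixpoint Ck (R : realType) (V W : normedModType R) (k : nat) (A : set V)
    (f : V -> W) : Prop :=
  if k is k'.+1 then
    (forall x, A x -> differentiable f x) /\
    (forall v, Ck k' A (fun x => 'D_v f x))
  else forall x, A x -> {for x, continuous f}.

Definition smooth_on (R : realType) (V W : normedModType R) (A : set V)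
    (f : V -> W) : Prop :=
  forall k, Ck k A f.

(** * Smooth manifolds *)

(* A homeomorphism from the open set [cdom] onto an open subset of R^m.
   Values of [cfun] outside [cdom], and of [cinv] outside the image, are
   irrelevant. *)
Record chart (R : realType) (T : topologicalType) (m : nat) := Chart {
  cdom : set T;
  cfun : T -> 'rV[R]_m;
  cinv : 'rV[R]_m -> T;
  cdom_open : open cdom;
  cimg_open : open (cfun @` cdom);
  cfunK : forall p, cdom p -> cinv (cfun p) = p;
  cfun_continuous : forall p, cdom p -> {for p, continuous cfun};
  cinv_continuous :
    forall x, (cfun @` cdom) x -> {for x, continuous cinv} }.

Record manifold (R : realType) (m : nat) := Manifold {
  carrier :> topologicalType;
  atlas : set (chart R carrier m);
  chart_at : carrier -> chart R carrier m;
  chart_at_atlas : forall p, atlas (chart_at p);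
  chart_at_dom : forall p, cdom (chart_at p) p;
  atlas_compat : forall c c', atlas c -> atlas c' ->
    smooth_on (cfun c @` (cdom c `&` cdom c')) (cfun c' \o cinv c);
  manifold_hausdorff : hausdorff_space carrier;
  manifold_second_countable : @second_countable carrier }.

(* The tangent space of M at p is R^m, a tangent vector being given by its
   components in the chosen chart [chart_at p]; [tvec R m] is the common model
   of all tangent spaces. *)
Notation tvec R m := ('rV[R]_m).

(* The coordinates of p in the chosen chart at p. *)
Definition pt (R : realType) (m : nat) (M : manifold R m) (p : M) : tvec R m :=
  cfun (chart_at p) p.

(* The differential T_p M -> T_(f p) N. *)
Definition tmap (R : realType) (m k : nat) (M : manifold R m)
    (N : manifold R k) (f : M -> N) (p : M) (v : tvec R m) : tvec R k :=
  'd (cfun (chart_at (f p)) \o f \o cinv (chart_at p)) (pt p) v.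

Definition smooth_map (R : realType) (m k : nat) (M : manifold R m)
    (N : manifold R k) (U : set M) (f : M -> N) : Prop :=
  (forall p, U p -> {for p, continuous f}) /\
  (forall c d, atlas c -> atlas d ->
     smooth_on (cfun c @` (cdom c `&` U `&` f @^-1` cdom d))
               (cfun d \o f \o cinv c)).

Definition diffeo (R : realType) (m k : nat) (M : manifold R m)
    (N : manifold R k) (U : set M) (V : set N) (f : M -> N) : Prop :=
  [/\ open U, open V, f @` U = V, smooth_map U f &
      exists g : N -> M, smooth_map V g /\ (forall p, U p -> g (f p) = p)].

Definition smooth_fun (R : realType) (m : nat) (M : manifold R m) (U : set M)
    (f : M -> R) : Prop :=
  forall c, atlas c -> smooth_on (cfun c @` (cdom c `&` U)) (f \o cinv c).

(** * Vector fields and forms *)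

(* Components of the vector field X in the chart c, at the coordinates x. *)
Definition field_in (R : realType) (m : nat) (M : manifold R m)
    (c : chart R M m) (X : M -> tvec R m) (x : tvec R m) : tvec R m :=
  let p := cinv c x in 'd (cfun c \o cinv (chart_at p)) (pt p) (X p).

Definition smooth_field (R : realType) (m : nat) (M : manifold R m)
    (U : set M) (X : M -> tvec R m) : Prop :=
  forall c, atlas c -> smooth_on (cfun c @` (cdom c `&` U)) (field_in c X).

(* Pullback of the one-form theta by the inverse of the chart c. *)
Definition form_in (R : realType) (m : nat) (M : manifold R m)
    (c : chart R M m) (theta : M -> tvec R m -> R) (x v : tvec R m) : R :=
  let p := cinv c x in theta p ('d (cfun (chart_at p) \o cinv c) x v).

Definition smooth_form (R : realType) (m : nat) (M : manifold R m)
    (U : set M) (theta : M -> tvec R m -> R) : Prop :=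
  (forall p, U p -> scalar (theta p)) /\
  (forall c v, atlas c ->
     smooth_on (cfun c @` (cdom c `&` U)) (fun x => form_in c theta x v)).

Definition fun_deriv (R : realType) (m : nat) (M : manifold R m)
    (f : M -> R) (p : M) (v : tvec R m) : R :=
  'D_v (f \o cinv (chart_at p)) (pt p).

Definition bracket (R : realType) (m : nat) (M : manifold R m)
    (X Y : M -> tvec R m) (p : M) : tvec R m :=
  'D_(X p) (field_in (chart_at p) Y) (pt p) -
  'D_(Y p) (field_in (chart_at p) X) (pt p).

(* Normalised by d theta(X,Y) = X(theta Y) - Y(theta X) - theta [X,Y]. *)
Definition ext_d (R : realType) (m : nat) (M : manifold R m)
    (theta : M -> tvec R m -> R) (p : M) (v w : tvec R m) : R :=
  'D_v (fun x => form_in (chart_at p) theta x w) (pt p) -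
  'D_w (fun x => form_in (chart_at p) theta x v) (pt p).

Lemma ltn_even_index n (i : 'I_n) : (i.*2 < n.*2)%N.
Proof. by rewrite ltn_double. Qed.

Lemma ltn_odd_index n (i : 'I_n) : (i.*2.+1 < n.*2)%N.
Proof. by rewrite ltn_Sdouble. Qed.

(* The n-th exterior power of a two-form Omega, evaluated on 2n vectors, with
   (a /\ b)(v) = 1/(p! q!) sum_s sgn(s) (a (x) b)(v o s). *)
Definition wedge_pow (R : realType) (E : Type) (n : nat)
    (Omega : E -> E -> R) (X : (n.*2).-tuple E) : R :=
  (2 ^+ n)^-1 *
  \sum_(s : 'S_(n.*2)) (-1) ^+ s *
    \prod_(i < n) Omega (tnth X (s (Ordinal (ltn_even_index i))))
                        (tnth X (s (Ordinal (ltn_odd_index i)))).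

(** * Distributions and bilinear forms on them *)

Definition local_section (R : realType) (m : nat) (M : manifold R m)
    (D : M -> {vspace tvec R m}) (V : set M) (X : M -> tvec R m) : Prop :=
  smooth_field V X /\ (forall p, V p -> X p \in D p).

Definition smooth_frame (R : realType) (m r : nat) (M : manifold R m)
    (D : M -> {vspace tvec R m}) (V : set M)
    (X : M -> r.-tuple (tvec R m)) : Prop :=
  (forall i, smooth_field V (fun p => tnth (X p) i)) /\
  (forall p, V p -> basis_of (D p) (X p)).

Definition distribution (R : realType) (m r : nat) (M : manifold R m)
    (D : M -> {vspace tvec R m}) : Prop :=
  forall p, exists V (X : M -> r.-tuple (tvec R m)),
    [/\ open V, V p & smooth_frame D V X].

Definition nondegenerate_on (R : realType) (m : nat)
    (D : {vspace tvec R m}) (b : tvec R m -> tvec R m -> R) : Prop :=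
  forall v, v \in D -> (forall w, w \in D -> b v w = 0) -> v = 0.

(* A contact distribution: locally the kernel of a one-form theta with
   d theta nondegenerate on the kernel. *)
Definition contact (R : realType) (n : nat) (M : manifold R n.*2.+1)
    (D : M -> {vspace tvec R n.*2.+1}) : Prop :=
  distribution n.*2 D /\
  (forall p, exists V (theta : M -> tvec R n.*2.+1 -> R),
     [/\ open V, V p, smooth_form V theta &
         forall q, V q ->
           (forall v, v \in D q <-> theta q v = 0) /\
           nondegenerate_on (D q) (ext_d theta q)]).

(* A smooth section of D^* (x) D^*; the values of b p off D p are
   irrelevant. *)
Definition smooth_bilinear (R : realType) (m : nat) (M : manifold R m)
    (D : M -> {vspace tvec R m})
    (b : M -> tvec R m -> tvec R m -> R) : Prop :=
  [/\ forall p a u v w, u \in D p -> v \in D p -> w \in D p ->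
        b p (a *: u + v) w = a * b p u w + b p v w,
      forall p a u v w, u \in D p -> v \in D p -> w \in D p ->
        b p w (a *: u + v) = a * b p w u + b p w v &
      forall V X Y, open V -> local_section D V X -> local_section D V Y ->
        smooth_fun V (fun p => b p (X p) (Y p))].

Definition pseudo_metric (R : realType) (m : nat) (M : manifold R m)
    (D : M -> {vspace tvec R m})
    (g : M -> tvec R m -> tvec R m -> R) : Prop :=
  [/\ smooth_bilinear D g,
      forall p v w, v \in D p -> w \in D p -> g p v w = g p w v &
      forall p, nondegenerate_on (D p) (g p)].

Definition two_form (R : realType) (m : nat) (M : manifold R m)
    (D : M -> {vspace tvec R m})
    (o : M -> tvec R m -> tvec R m -> R) : Prop :=
  smooth_bilinear D o /\ (forall p v, v \in D p -> o p v v = 0).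

Definition tangent (R : realType) (m : nat) (M : manifold R m) :
    M -> {vspace tvec R m} :=
  fun _ => fullv.

(* [pos p X] : X is a positively oriented frame of D p. *)
Definition orientation (R : realType) (m r : nat) (M : manifold R m)
    (D : M -> {vspace tvec R m})
    (pos : M -> r.-tuple (tvec R m) -> Prop) : Prop :=
  [/\ forall p X, pos p X -> basis_of (D p) X,
      forall p X (Y : r.-tuple (tvec R m)), pos p X -> basis_of (D p) Y ->
        (pos p Y <-> 0 < \det (\matrix_(i, j) coord X j (tnth Y i))) &
      forall p, exists V X,
        [/\ open V, V p, smooth_frame D V X & forall q, V q -> pos q (X q)]].

(** * Contact sub-pseudo-Riemannian structures *)

Record contact_spr (R : realType) (n : nat) (M : manifold R n.*2.+1) :=
  ContactSPR {
    dist : M -> {vspace tvec R n.*2.+1};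
    metric : M -> tvec R n.*2.+1 -> tvec R n.*2.+1 -> R;
    pos_frame : M -> (n.*2).-tuple (tvec R n.*2.+1) -> Prop;
    dist_contact : contact dist;
    metricP : pseudo_metric dist metric;
    pos_frameP : orientation dist pos_frame }.

Definition orthonormal (R : realType) (E : Type) (r : nat)
    (b : E -> E -> R) (X : r.-tuple E) : Prop :=
  (forall i j, i != j -> b (tnth X i) (tnth X j) = 0) /\
  (forall i, b (tnth X i) (tnth X i) = 1 \/ b (tnth X i) (tnth X i) = -1).

Definition normalised_form (R : realType) (n : nat) (M : manifold R n.*2.+1)
    (S : contact_spr M) (alpha : M -> tvec R n.*2.+1 -> R) : Prop :=
  [/\ smooth_form setT alpha,
      forall p v, v \in dist S p -> alpha p v = 0 &
      forall p X, pos_frame S p X -> orthonormal (metric S p) X ->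
        wedge_pow (ext_d alpha p) X = (-1) ^+ n].

Definition reeb_field (R : realType) (m : nat) (M : manifold R m)
    (alpha : M -> tvec R m -> R) (X0 : M -> tvec R m) : Prop :=
  [/\ smooth_field setT X0,
      forall p v, ext_d alpha p (X0 p) v = 0 &
      forall p, alpha p (X0 p) = 1].

Definition omega (R : realType) (m : nat) (M : manifold R m)
    (alpha : M -> tvec R m -> R) (p : M) (v w : tvec R m) : R :=
  - ext_d alpha p v w.

(* (L_Z b)(X, Y) *)
Definition lie_deriv (R : realType) (m : nat) (M : manifold R m)
    (Z : M -> tvec R m) (b : M -> tvec R m -> tvec R m -> R)
    (X Y : M -> tvec R m) (p : M) : R :=
  fun_deriv (fun q => b q (X q) (Y q)) p (Z p)
  - b p (bracket Z X p) (Y p) - b p (X p) (bracket Z Y p).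

Definition h_tensor (R : realType) (m : nat) (M : manifold R m)
    (Z : M -> tvec R m) (g : M -> tvec R m -> tvec R m -> R)
    (X Y : M -> tvec R m) (p : M) : R :=
  2^-1 * lie_deriv Z g X Y p.

(* Vanishing of a tensor on D given by its values on local sections. *)
Definition vanishes (R : realType) (m : nat) (M : manifold R m)
    (D : M -> {vspace tvec R m})
    (t : (M -> tvec R m) -> (M -> tvec R m) -> M -> R) : Prop :=
  forall V X Y p, open V -> local_section D V X -> local_section D V Y -> V p ->
    t X Y p = 0.

(** * The local space of trajectories *)

Definition same_trajectory (R : realType) (m : nat) (M : manifold R m)
    (X : M -> tvec R m) (U : set M) (p q : M) : Prop :=
  exists (gamma : R -> M) (a b s t : R),
    [/\ s \in `]a, b[, t \in `]a, b[, gamma s = p, gamma t = q &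
        forall u, u \in `]a, b[ ->
          [/\ U (gamma u), {for u, continuous gamma} &
              is_derive u 1 (fun r => cfun (chart_at (gamma u)) (gamma r))
                (X (gamma u))]].

(* N is the manifold of trajectories of X in the open set U, with
   projection pi. *)
Definition trajectory_space (R : realType) (m k : nat) (M : manifold R m)
    (X : M -> tvec R m) (U : set M) (N : manifold R k) (pi : M -> N) : Prop :=
  [/\ open U, smooth_map U pi,
      forall p, U p -> forall w, exists v, tmap pi p v = w,
      pi @` U = setT &
      forall p q, U p -> U q -> (pi p = pi q <-> same_trajectory X U p q)].

(* The pullback of b' by f coincides with b on D. *)
Definition pulls_back_to (R : realType) (m k : nat) (M : manifold R m)
    (N : manifold R k) (D : M -> {vspace tvec R m}) (U : set M)
    (f : M -> N)
    (b : M -> tvec R m -> tvec R m -> R)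
    (b' : N -> tvec R k -> tvec R k -> R) : Prop :=
  forall p v w, U p -> v \in D p -> w \in D p ->
    b' (f p) (tmap f p v) (tmap f p w) = b p v w.

(* Main.v *)
(** Consider the pairs (x, y) of points of M1 and M2 lying over points of N1
    and N2 that correspond under phi.  On this manifold of pairs the one-form
    alpha2 - alpha1 is closed, because d alpha_a is the pullback of - o_a and
    phi matches o1 with o2; so locally it is dG, with G (q1, q2) = 0.  The Reeb
    fields are transverse to the hypersurface G = 0, which is therefore the
    graph of a map F.  By construction F covers phi and F^* alpha2 = alpha1;
    since both D_a = ker alpha_a and the metric on D_a (pulled back from N_a)
    are determined by these data, F is the required diffeomorphism.

    In coordinates M2 is straightened along its Reeb field, so that the
    manifold of pairs becomes an open subset of R x M1 and the Poincare lemma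
    and the inverse function theorem apply. *)
Require Import Defs.
From HB Require Import structures.
From mathcomp Require Import all_boot all_order all_algebra all_fingroup.
From mathcomp Require Import all_classical all_reals all_analysis.
Import Order.TTheory GRing.Theory Num.Theory.
Import numFieldNormedType.Exports.
Local Open Scope classical_set_scope.
Local Open Scope ring_scope.
From mathcomp Require Import ring lra.

Set Implicit Arguments.
Unset Strict Implicit.
Unset Printing Implicit Defensive.

(** * Calculus of C^k maps *)

(** No flow of a Reeb field is integrated. Instead alpha2, read in a chart and frozen at q2, is a
    linear function; together with the coordinates of the projection it has injective differential
    at q2, so the inverse function theorem supplies coordinates in which the fibres of the
    projection are lines. The injectivity comes from the metric: a vector of D_a with zero
    projection is orthogonal to all of D_a, hence zero. The same argument makes the differential of
    phi injective. It also yields local invertibility of F, since a vector killed by dF is killed by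
    alpha1 and by the differential of phi composed with the projection. Closedness of alpha2 -
    alpha1 concerns all tangent vectors, while o_a is tied to d alpha_a on D_a only; both d alpha_a
    and the projection ignore Reeb components, which closes this gap. Tangent vectors at p are
    stored as components in [chart_at p], which may jump from point to point. Hence the analysis is
    done on open subsets of row spaces and carried to manifolds through fixed charts. *)

Section Differentials.
Context {R : realType}.
Implicit Types V W : normedModType R.

Lemma diff_eps V W (f : V -> W) x : differentiable f x ->
  forall e, 0 < e -> \forall h \near (0 : V),
    `|f (h + x) - f x - 'd f x h| <= e * `|h|.
Proof.
move=> /diff_locallyP[_ /eqaddoP fx] e e0.
by near do rewrite -addrA -opprD; exact: fx.
Unshelve. all: by end_near. Qed.

(** By uniqueness of differentials the estimate also identifies [L]; the differentials of inverse
    maps and of integrals are found this way. *)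
Lemma eps_diff V W (f : V -> W) (L : {linear V -> W}) x : continuous L ->
  (forall e, 0 < e -> \forall h \near (0 : V),
    `|f (h + x) - f x - L h| <= e * `|h|) ->
  differentiable f x /\ 'd f x = L :> (V -> W).
Proof.
move=> Lc fx.
have fL : f \o shift x = cst (f x) + L +o_ 0 id.
  apply/eqaddoP => e e0; have := fx e e0.
  by apply: filterS => h; rewrite -addrA -opprD.
by have dL := diff_unique Lc fL; split => //; apply/diff_locallyP; rewrite dL.
Qed.

Lemma near_eq_diff V W (f g : V -> W) x : (\near x, f x = g x) ->
  differentiable f x -> differentiable g x /\ 'd g x = 'd f x :> (V -> W).
Proof.
move=> fg df; apply: eps_diff; first exact: diff_continuous.
move=> e e0; have := diff_eps df e0.
have fg0 : \forall h \near (0 : V), f (h + x) = g (h + x).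
  move: fg; rewrite (near_shift 0) /= subr0.
  by apply: filterS => h.
have fgx : f x = g x by exact: nbhs_singleton fg.
by apply: filterS2 fg0 => h <-; rewrite fgx.
Qed.

Lemma open_near V (A : set V) x : open A -> A x -> \near x, A x.
Proof. by move=> oA Ax; exact: open_nbhs_nbhs. Qed.

Lemma near_norm_lt V W (f : V -> W) x r : {for x, continuous f} ->
  `|f x| < r -> \forall y \near x, `|f y| < r.
Proof. by move=> fc fx; apply: cvgr_norm_lt fx; exact: fc. Qed.

Lemma near_dist_lt V W (f : V -> W) x e : {for x, continuous f} -> 0 < e ->
  \forall y \near x, `|f x - f y| < e.
Proof. by move=> fc e0; move/cvgrPdist_lt : fc; apply. Qed.

Lemma rV_linear_sum {n : nat} (W : lmodType R) (L : {linear 'rV[R]_n -> W}) v :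
  L v = \sum_j v 0 j *: L (delta_mx 0 j).
Proof.
rewrite [in LHS](row_sum_delta v) linear_sum; apply: eq_bigr => j _.
by rewrite linearZ.
Qed.

Lemma rV_linear_continuous {n : nat} W (L : {linear 'rV[R]_n -> W}) :
  continuous L.
Proof.
have -> : L = (fun v => \sum_j v 0 j *: L (delta_mx 0 j)) :> (_ -> _).
  by apply/funext => v; exact: rV_linear_sum.
elim: (index_enum _) => [|j r IH] v.
  under eq_fun do rewrite big_nil.
  exact: cst_continuous.
under eq_fun do rewrite big_cons.
have cj : {for v, continuous (fun v : 'rV[R]_n => v 0 j)}.
  exact: coord_continuous.
exact: (continuousD (continuousZr_tmp cj) (IH v)).
Qed.

Lemma diff_rV {n : nat} W (f : 'rV[R]_n -> W) x v : differentiable f x ->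
  'd f x v = \sum_j v 0 j *: 'D_(delta_mx 0 j) f x.
Proof.
move=> fx; rewrite rV_linear_sum; apply: eq_bigr => j _.
by rewrite deriveE.
Qed.

Lemma derive_comp {n : nat} V W (f : V -> 'rV[R]_n) (g : 'rV[R]_n -> W) x v :
  differentiable f x -> differentiable g (f x) ->
  'D_v (g \o f) x = \sum_j ('D_v f x) 0 j *: 'D_(delta_mx 0 j) g (f x).
Proof.
move=> fx gx; rewrite deriveE; last exact: differentiable_comp.
by rewrite diff_comp //= diff_rV // deriveE.
Qed.

Lemma deriveZv V W (f : V -> W) x a v : differentiable f x ->
  'D_(a *: v) f x = a *: 'D_v f x.
Proof. by move=> df; rewrite !deriveE// linearZ. Qed.

Lemma deriveDv V W (f : V -> W) x u v : differentiable f x ->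
  'D_(u + v) f x = 'D_u f x + 'D_v f x.
Proof. by move=> df; rewrite !deriveE// linearD. Qed.

Lemma derive_lin V W W' (L : {linear W -> W'}) (f : V -> W) x v :
  continuous L -> differentiable f x -> 'D_v (L \o f) x = L ('D_v f x).
Proof.
move=> Lc df; have dL : differentiable L (f x) by exact: linear_differentiable.
rewrite deriveE; last exact: differentiable_comp.
by rewrite diff_comp// diff_lin//= deriveE.
Qed.

End Differentials.

(** * Closure properties of C^k and smooth maps *)

Section Ck_theory.
Context {R : realType}.
Implicit Types V W : normedModType R.

Lemma Ck_subset V W k (A B : set V) (f : V -> W) :
  B `<=` A -> Ck k A f -> Ck k B f.
Proof.
elim: k f => [|k IH] f BA /=; first by move=> + x /BA; apply.
by case=> df Df; split=> [x /BA|v]; [exact: df|exact: IH].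
Qed.

Lemma Ck_ext V W k (A : set V) (f g : V -> W) : open A ->
  (forall x, A x -> f x = g x) -> Ck k A f -> Ck k A g.
Proof.
move=> oA; elim: k f g => [|k IH] f g fg /=.
  move=> fA x Ax; apply: cvg_trans; last by rewrite -(fg _ Ax); exact: fA.
  apply: near_eq_cvg; apply: filterS (open_near oA Ax) => y.
  exact: fg.
have nfg x : A x -> \near x, f x = g x.
  by move=> Ax; apply: filterS (open_near oA Ax).
case=> df Df; split=> [x Ax|v].
  by have [] := near_eq_diff (nfg x Ax) (df x Ax).
apply: IH (Df v) => x Ax; apply: near_eq_derive; exact: nfg.
Qed.

Lemma Ck_pred V W k (A : set V) (f : V -> W) : Ck k.+1 A f -> Ck k A f.
Proof.
elim: k f => [|k IH] f /= [df Df].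
  by move=> x Ax; exact: differentiable_continuous (df x Ax).
by split=> // v; exact: IH.
Qed.

Lemma Ck_cst V W k (A : set V) (c : W) : Ck k A (cst c).
Proof.
elim: k c => [|k IH] c /=; first by move=> x _; exact: cst_continuous.
split=> [x _|v]; first exact: differentiable_cst.
rewrite (_ : (fun x => _) = cst 0); first exact: IH.
by apply/funext => x; exact: derive_cst.
Qed.

Lemma Ck_linear V W k (A : set V) (L : {linear V -> W}) :
  continuous L -> Ck k A L.
Proof.
move=> Lc; case: k => [|k] /=; first by move=> x _; exact: Lc.
split=> [x _|v]; first exact: linear_differentiable.
rewrite (_ : (fun x => _) = cst (L v)); first exact: Ck_cst.
by apply/funext => x; rewrite deriveE ?diff_lin//; exact: linear_differentiable.
Qed.

Lemma Ck_add V W k (A : set V) (f g : V -> W) : open A ->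
  Ck k A f -> Ck k A g -> Ck k A (fun x => f x + g x).
Proof.
move=> oA; elim: k f g => [|k IH] f g /=.
  by move=> fA gA x Ax; apply: continuousD; [exact: fA|exact: gA].
move=> [df Df] [dg Dg]; split=> [x Ax|v].
  by apply: (@differentiableD _ _ _ f g); [exact: df|exact: dg].
apply: (@Ck_ext _ _ _ _ (fun x => 'D_v f x + 'D_v g x)) => //; last exact: IH.
move=> x Ax; rewrite (@deriveD _ _ _ f g)//; apply: diff_derivable.
  exact: df.
exact: dg.
Qed.

Lemma Ck_sum V W k (A : set V) (I : Type) (r : seq I) (f : I -> V -> W) :
  open A -> (forall i, Ck k A (f i)) ->
  Ck k A (fun x => \sum_(i <- r) f i x).
Proof.
move=> oA fA; elim: r => [|i r IH].
  by under eq_fun do rewrite big_nil; exact: Ck_cst.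
under eq_fun do rewrite big_cons.
exact: (Ck_add oA (fA i) IH).
Qed.

Lemma Ck_mul V k (A : set V) (f g : V -> R) : open A ->
  Ck k A f -> Ck k A g -> Ck k A (fun x => f x * g x).
Proof.
move=> oA; elim: k f g => [|k IH] f g.
  by move=> fA gA x Ax; apply: continuousM; [exact: fA|exact: gA].
(* The Leibniz formula contains [f] and [g] themselves next to their derivatives, so both are needed
   at order k as well. *)
move=> hf hg; have fA := Ck_pred hf; have gA := Ck_pred hg.
case: hf hg => [df Df] [dg Dg].
split=> [x Ax|v].
  by apply: (@differentiableM _ _ f g); [exact: df|exact: dg].
apply: (@Ck_ext _ _ _ _ (fun x => f x * 'D_v g x + g x * 'D_v f x)) => //; last first.
  by apply: Ck_add => //; [exact: IH fA (Dg v)|exact: IH gA (Df v)].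
move=> x Ax; rewrite (@deriveM _ _ f g)//; apply: diff_derivable.
  exact: df.
exact: dg.
Qed.

Lemma Ck_lin_comp V W W' k (A : set V) (L : {linear W -> W'}) (f : V -> W) :
  open A -> continuous L -> Ck k A f -> Ck k A (L \o f).
Proof.
move=> oA Lc; elim: k f => [|k IH] f.
  by move=> fA x Ax; apply: continuous_comp; [exact: fA|exact: Lc].
move=> [df Df]; split=> [x Ax|v].
  by apply: differentiable_comp; [exact: df|exact: linear_differentiable].
apply: (@Ck_ext _ _ _ _ (L \o 'D_v f)) => //; last exact: IH (Df v).
by move=> x Ax; rewrite derive_lin//; exact: df.
Qed.

(** [coord] and [scalev] are named so that they can carry linear structures; [Ck_lin_comp] then
    splits row-valued maps into coordinates and reassembles them. *)
Definition coord {n : nat} (j : 'I_n) (x : 'rV[R]_n) : R := x 0 j.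

Fact coord_is_linear n (j : 'I_n) : linear (@coord n j).
Proof. by move=> a x y; rewrite /coord !mxE. Qed.

HB.instance Definition _ n (j : 'I_n) :=
  GRing.isLinear.Build R 'rV[R]_n R _ (@coord n j) (@coord_is_linear n j).

Definition scalev {W} (w : W) (a : R) : W := a *: w.

Fact scalev_is_linear W (w : W) : linear (scalev w).
Proof. by move=> a x y; rewrite /scalev scalerDl scalerA. Qed.

HB.instance Definition _ W (w : W) :=
  GRing.isLinear.Build R R W _ (scalev w) (scalev_is_linear w).

Lemma Ck_coord V k n (A : set V) (f : V -> 'rV[R]_n) j : open A ->
  Ck k A f -> Ck k A (fun x => f x 0 j).
Proof.
move=> oA; apply: (@Ck_lin_comp _ _ _ _ _ (coord j)) => //.
exact: rV_linear_continuous.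
Qed.

Lemma Ck_rV V k n (A : set V) (f : V -> 'rV[R]_n) : open A ->
  (forall j, Ck k A (fun x => f x 0 j)) -> Ck k A f.
Proof.
move=> oA fA.
rewrite (_ : f = fun x => \sum_j f x 0 j *: delta_mx 0 j); last first.
  by apply/funext => x; exact: row_sum_delta.
apply: Ck_sum => // j.
apply: (@Ck_lin_comp _ _ _ _ _ (scalev (delta_mx 0 j))) => //.
exact: scalel_continuous.
Qed.

(** The induction generalises [g] but keeps [f]: the chain rule yields partial derivatives of [g]
    composed with the same [f]. With a scalar target it is a sum of products. *)
Lemma Ck_comp V k n (A : set V) (B : set 'rV[R]_n)
    (f : V -> 'rV[R]_n) (g : 'rV[R]_n -> R) : open A ->
  (forall x, A x -> B (f x)) -> Ck k A f -> Ck k B g -> Ck k A (g \o f).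
Proof.
move=> oA AB; elim: k g => [|k IH] g fA gB.
  by move=> x Ax; apply: continuous_comp; [exact: fA|exact/gB/AB].
have fk := Ck_pred fA; case: fA gB => [df Df] [dg Dg].
split=> [x Ax|v].
  by apply: differentiable_comp; [exact: df|exact/dg/AB].
apply: (@Ck_ext _ _ _ _ (fun x => \sum_j
   ('D_v f x 0 j * 'D_(delta_mx 0 j) g (f x)))) => //.
  by move=> x Ax; rewrite derive_comp//; [exact: df|exact/dg/AB].
apply: Ck_sum => // j; apply: Ck_mul => //; last exact: IH fk (Dg _).
exact: Ck_coord (Df v).
Qed.
Lemma Ck_scale V W k (A : set V) (a : R) (f : V -> W) : open A ->
  Ck k A f -> Ck k A (fun x => a *: f x).
Proof.
move=> oA; apply: (@Ck_lin_comp _ _ _ _ _ ( *:%R a)) => //.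
exact: scaler_continuous.
Qed.

Lemma Ck_sub V W k (A : set V) (f g : V -> W) : open A ->
  Ck k A f -> Ck k A g -> Ck k A (fun x => f x - g x).
Proof.
move=> oA fA gA; apply: (Ck_add oA fA).
rewrite (_ : (fun x => _) = (fun x => -1 *: g x)); first exact: Ck_scale.
by apply/funext => x; rewrite scaleN1r.
Qed.

(** The derivative of 1/f is -(1/f)^2 times that of f, so order k of 1/f yields order k+1. *)
Lemma Ck_inv V k (A : set V) (f : V -> R) : open A ->
  (forall x, A x -> f x != 0) -> Ck k A f -> Ck k A (fun x => (f x)^-1).
Proof.
move=> oA f0; elim: k => [|k IH] fA.
  by move=> x Ax; apply: cvgV; [exact: f0|exact: fA].
have fk := IH (Ck_pred fA); case: fA => [df Df].
split=> [x Ax|v].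
  by apply: differentiableV; [exact: df|exact: f0].
apply: (@Ck_ext _ _ _ _ (fun x => -1 *: ((f x)^-1 * (f x)^-1 * 'D_v f x))) => //.
  move=> x Ax; rewrite deriveV; [|exact: f0|exact/diff_derivable/df].
  by rewrite expr2 invfM scaleN1r scaleNr.
apply: Ck_scale => //; apply: Ck_mul => //; last exact: Df.
exact: Ck_mul.
Qed.

Lemma Ck_prod V k (A : set V) (I : Type) (r : seq I) (f : I -> V -> R) :
  open A -> (forall i, Ck k A (f i)) ->
  Ck k A (fun x => \prod_(i <- r) f i x).
Proof.
move=> oA fA; elim: r => [|i r IH].
  by under eq_fun do rewrite big_nil; exact: Ck_cst.
under eq_fun do rewrite big_cons.
exact: (Ck_mul oA (fA i) IH).
Qed.

Lemma Ck_det V k n (A : set V) (M : V -> 'M[R]_n) : open A ->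
  (forall i j, Ck k A (fun x => M x i j)) -> Ck k A (fun x => \det (M x)).
Proof.
move=> oA MA; apply: Ck_sum => // s; apply: Ck_mul => //; first exact: Ck_cst.
exact: Ck_prod.
Qed.

Lemma Ck_row_mx V k m n (A : set V) (f : V -> 'rV[R]_m) (g : V -> 'rV[R]_n) :
  open A -> Ck k A f -> Ck k A g -> Ck k A (fun x => row_mx (f x) (g x)).
Proof.
move=> oA fA gA; apply: Ck_rV => // j; rewrite -[j](fintype.splitK).
case: (fintype.split j) => i /=.
  by under eq_fun do rewrite row_mxEl; exact: Ck_coord.
by under eq_fun do rewrite row_mxEr; exact: Ck_coord.
Qed.

Lemma Ck_compV V k m n (A : set V) (B : set 'rV[R]_n)
    (f : V -> 'rV[R]_n) (g : 'rV[R]_n -> 'rV[R]_m) : open A ->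
  (forall x, A x -> B (f x)) -> open B -> Ck k A f -> Ck k B g -> Ck k A (g \o f).
Proof.
move=> oA AB oB fA gB; apply: Ck_rV => // j.
by apply: (Ck_comp oA AB fA (g := fun x => g x 0 j)); exact: Ck_coord.
Qed.

Lemma smooth_diff V W (A : set V) (f : V -> W) x :
  smooth_on A f -> A x -> differentiable f x.
Proof. by move=> /(_ 1%N)[df _]; exact: df. Qed.

Lemma smooth_continuous V W (A : set V) (f : V -> W) x :
  smooth_on A f -> A x -> {for x, continuous f}.
Proof. by move=> /(_ 0%N); apply. Qed.

Lemma smooth_derive V W (A : set V) (f : V -> W) v :
  smooth_on A f -> smooth_on A ('D_v f).
Proof. by move=> fA k; have [_] := fA k.+1; apply. Qed.

Lemma smooth_subset V W (A B : set V) (f : V -> W) :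
  B `<=` A -> smooth_on A f -> smooth_on B f.
Proof. by move=> BA fA k; exact: Ck_subset BA (fA k). Qed.

Lemma smooth_ext V W (A : set V) (f g : V -> W) : open A ->
  (forall x, A x -> f x = g x) -> smooth_on A f -> smooth_on A g.
Proof. by move=> oA fg fA k; exact: Ck_ext oA fg (fA k). Qed.

Lemma smooth_comp V m n (A : set V) (B : set 'rV[R]_n)
    (f : V -> 'rV[R]_n) (g : 'rV[R]_n -> 'rV[R]_m) : open A -> open B ->
  (forall x, A x -> B (f x)) -> smooth_on A f -> smooth_on B g ->
  smooth_on A (g \o f).
Proof. by move=> oA oB AB fA gB k; exact: Ck_compV oA AB oB (fA k) (gB k). Qed.

End Ck_theory.

(** * Mean value estimates *)

Section Mean_value.
Context {R : realType}.

Lemma rV_norm_le n (x : 'rV[R]_n) K : 0 <= K ->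
  (forall j, `|x 0 j| <= K) -> `|x| <= K.
Proof.
move=> K0 xK; rewrite [leLHS]/Num.Def.normr/= mx_normrE.
by apply: bigmax_le => //= -[i j] _ /=; rewrite ord1.
Qed.

Lemma rV_coord_le n (x : 'rV[R]_n) j : `|x 0 j| <= `|x|.
Proof.
rewrite [leRHS]/Num.Def.normr/= mx_normrE.
exact: (le_bigmax _ (fun i => `|x i.1 i.2|) (0, j)).
Qed.

Lemma norm_segment_le (V : normedModType R) (x a b : V) t : 0 <= t <= 1 ->
  `|a + t *: (b - a) - x| <= Num.max `|a - x| `|b - x|.
Proof.
move=> /andP[t0 t1].
have -> : a + t *: (b - a) - x = (1 - t) *: (a - x) + t *: (b - x).
  rewrite scalerBl scale1r -[RHS]addrA [- _ + _]addrC -scalerBr opprB addrA subrK.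
  by rewrite addrAC.
apply: le_trans (ler_normD _ _) _; rewrite !normrZ !ger0_norm ?subr_ge0//.
set M := Num.max _ _.
have aM : (1 - t) * `|a - x| <= (1 - t) * M.
  by rewrite ler_wpM2l ?subr_ge0// le_max lexx.
have bM : t * `|b - x| <= t * M by rewrite ler_wpM2l// le_max lexx orbT.
by apply: le_trans (lerD aM bM) _; rewrite -mulrDl subrK mul1r.
Qed.

Lemma is_derive_line (V W : normedModType R) (f : V -> W) a h (t : R) :
  differentiable f (a + t *: h) ->
  is_derive t 1 (fun s : R => f (a + s *: h)) ('D_h f (a + t *: h)).
Proof.
move=> df.
have lc : continuous (scalev h : R -> V) by exact: scalel_continuous.
have dh : differentiable (scalev h : R -> V) t by exact: linear_differentiable.
have dk : differentiable (cst a : R -> V) t by [].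
have dl : differentiable (cst a + scalev h : R -> V) t.
  exact: differentiableD.
have dc : differentiable (f \o (cst a + scalev h : R -> V)) t.
  by apply: differentiable_comp.
apply: DeriveDef; first exact: diff_derivable dc.
rewrite -[LHS]/('D_1 (f \o (cst a + scalev h)) t) deriveE// diff_comp//=.
rewrite diffD//.
by rewrite /= diff_cst diff_lin//= /scalev scale1r add0r deriveE.
Qed.

Lemma mvt_line (V : normedModType R) (f : V -> R) a h :
  (forall t : R, 0 <= t <= 1 -> differentiable f (a + t *: h)) ->
  exists2 t : R, 0 < t < 1 & f (a + h) - f a = 'D_h f (a + t *: h).
Proof.
move=> df.
have [||t t01] := @MVT R (fun s : R => f (a + s *: h))
    (fun t : R => 'D_h f (a + t *: h)) 0 1 ltr01.
- move=> t; rewrite in_itv/= => /andP[t0 t1].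
  by apply: is_derive_line; apply: df; rewrite !ltW.
- apply: derivable_within_continuous => t; rewrite in_itv/= => t01.
  by have [] := is_derive_line (df t t01).
by rewrite scale1r scale0r addr0 subr0 mulr1 => ->; exists t => //.
Qed.

(** The norm of a row is the maximum over its coordinates, so the scalar mean value theorem serves
    each coordinate, with an intermediate point of its own. *)
Lemma mean_value_le (V : normedModType R) n (f : V -> 'rV[R]_n) a h K :
  (forall t : R, 0 <= t <= 1 -> differentiable f (a + t *: h)) ->
  (forall t : R, 0 <= t <= 1 -> `|'D_h f (a + t *: h)| <= K) ->
  `|f (a + h) - f a| <= K.
Proof.
move=> df fK; apply: rV_norm_le => [|j].
  by apply: le_trans (fK 0 _); rewrite ?normr_ge0 ?lexx ?ler01.
have dj t : 0 <= t <= 1 -> differentiable (fun x => f x 0 j) (a + t *: h).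
  by move=> /df dft; exact: (differentiable_comp dft (differentiable_coord _ _ _)).
have [t /andP[t0 t1] e] := mvt_line dj.
have t01 : 0 <= t <= 1 by rewrite !ltW.
rewrite !mxE e; apply: le_trans (fK t t01).
apply: le_trans (rV_coord_le _ j).
have := derive_mx (@diff_derivable _ _ _ _ _ h (df t t01)).
by move=> ->; rewrite mxE.
Qed.

End Mean_value.

(** * The inverse function theorem *)

Section Inverse_function.
Context {R : realType} {n : nat}.
Implicit Types f g : 'rV[R]_n -> 'rV[R]_n.

Definition jac f x : 'M[R]_n := lin1_mx ('d f x).

Lemma jacE f x v : 'd f x v = v *m jac f x.
Proof. by rewrite /jac mul_rV_lin1. Qed.

Lemma jac_unit f x : (forall v, 'd f x v = 0 -> v = 0) -> jac f x \in unitmx.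
Proof.
move=> inj; rewrite -row_free_unit -kermx_eq0; apply/eqP/row_matrixP => i.
rewrite row0; apply: inj; rewrite jacE; apply/sub_kermxP.
exact: row_sub.
Qed.

Lemma jac_coef f x i j : differentiable f x ->
  jac f x i j = 'D_(delta_mx 0 i) f x 0 j.
Proof. by move=> df; rewrite deriveE// jacE -rowE [RHS]mxE. Qed.

Lemma invmx_coef (M : 'M[R]_n) i j : M \in unitmx ->
  invmx M i j = (\det M)^-1 * cofactor M j i.
Proof. by move=> Mu; rewrite /invmx Mu !mxE. Qed.

(** By Cramer's rule the entries are cofactors, themselves determinants, divided by a nonvanishing
    determinant. *)
Lemma Ck_invmx k (A : set 'rV[R]_n) (M : 'rV[R]_n -> 'M[R]_n) :
  open A -> (forall x, A x -> M x \in unitmx) ->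
  (forall i j, Ck k A (fun x => M x i j)) ->
  forall i j, Ck k A (fun x => invmx (M x) i j).
Proof.
move=> oA Mu MA i j.
apply: (@Ck_ext _ _ _ _ _ (fun x => (\det (M x))^-1 * cofactor (M x) j i)) => //.
  by move=> x Ax; rewrite invmx_coef//; exact: Mu.
apply: Ck_mul => //.
  apply: Ck_inv => // [x Ax|]; last exact: Ck_det.
  by have := Mu x Ax; rewrite unitmxE unitfE.
apply: Ck_mul => //; first exact: Ck_cst.
apply: Ck_det => // i' j'.
by under eq_fun do rewrite !mxE; exact: MA.
Qed.

(** Bootstrapping: the derivative of [g] is the inverse Jacobian of [f] evaluated along [g], so it
    is as regular as [g], and [g] gains one order. *)
Lemma inverse_smooth (V W : set 'rV[R]_n) f g : open V -> open W ->
  smooth_on V f -> (forall y, W y -> V (g y)) ->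
  (forall y, W y -> differentiable g y) ->
  (forall y, W y -> jac f (g y) \in unitmx) ->
  (forall y v, W y -> 'd g y v = v *m invmx (jac f (g y))) ->
  smooth_on W g.
Proof.
move=> oV oW fV gWV dg Ju Dg; elim=> [|k IH].
  by move=> y Wy; exact: differentiable_continuous (dg y Wy).
split=> // v.
apply: (@Ck_ext _ _ _ _ _ (fun y => v *m invmx (jac f (g y)))) => //.
  by move=> y Wy; rewrite deriveE; [rewrite Dg|exact: dg].
apply: Ck_rV => // j; under eq_fun do rewrite mxE.
apply: Ck_sum => // i; apply: Ck_mul => //; first exact: Ck_cst.
apply: Ck_invmx => // i' j'.
apply: (@Ck_ext _ _ _ _ _ ((fun x => 'D_(delta_mx 0 i') f x 0 j') \o g)) => //.
  by move=> y Wy /=; rewrite jac_coef//; apply: smooth_diff fV _; exact: gWV.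
apply: (Ck_comp oW gWV IH).
by apply: Ck_coord => //; exact: (smooth_derive _ fV).
Qed.

(** Expand [f] at [g y] along s = g (h + y) - g y. The first-order error of [g] is minus the inverse
    Jacobian applied to the error of [f]; the latter is small against |s|, and |s| is at most a
    multiple of |h|. *)
Lemma inverse_differentiable (W : set 'rV[R]_n) f g y K : open W -> W y ->
  differentiable f (g y) -> jac f (g y) \in unitmx ->
  (forall z, W z -> f (g z) = z) ->
  (forall z, W z -> `|g z - g y| <= K * `|z - y|) ->
  differentiable g y /\ (forall v, 'd g y v = v *m invmx (jac f (g y))).
Proof.
move=> oW Wy df Ju fg gK.
set T := invmx _.
have [k k0 Tk] := linear_lipschitz (@rV_linear_continuous _ _ _ (mulmxr T)).
suff: differentiable g y /\ 'd g y = mulmxr T :> (_ -> _).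
  by case=> dg e; split=> // v; rewrite e.
apply: eps_diff; first exact: rV_linear_continuous.
move=> e e0.
(* [K] carries no sign; a positive constant is needed to divide by. *)
pose K' := Num.max K 1.
have K'0 : 0 < K' by rewrite lt_max ltr01 orbT.
have gK' z : W z -> `|g z - g y| <= K' * `|z - y|.
  by move=> /gK /le_trans; apply; rewrite ler_wpM2r// le_max lexx.
(* [k] is a Lipschitz constant of the inverse Jacobian, so this tolerance for [f] gives exactly [e]
   for [g]. *)
have e'0 : 0 < e / (k * K') by rewrite divr_gt0// mulr_gt0.
have [d /= d0 fd] := nbhs_norm0P.1 (diff_eps df e'0).
have nW : \forall h \near (0 : 'rV[R]_n), W (h + y).
  have := open_near oW Wy; rewrite (near_shift 0) /= subr0.
  by apply: filterS.
near=> h.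
have Wh : W (h + y) by near: h.
set s := g (h + y) - g y.
have sh : `|s| <= K' * `|h| by have := gK' _ Wh; rewrite addrK.
have sd : `|s| < d.
  apply: le_lt_trans sh _; rewrite -ltr_pdivlMl//; near: h.
  by apply: (@nbhs0_lt R 'rV[R]_n); rewrite mulr_gt0// invr_gt0.
have := fd s sd; rewrite /s subrK fg// fg// addrK -/s => hs.
have -> : s - mulmxr T h = - mulmxr T (h - 'd f (g y) s).
  by rewrite linearB /= opprB jacE mulmxK//.
rewrite normrN; apply: le_trans (Tk _) _.
apply: (@le_trans _ _ (k * (e / (k * K') * `|s|))).
  by rewrite ler_wpM2l// ltW.
have -> : k * (e / (k * K') * `|s|) = e * (K'^-1 * `|s|).
  by field; rewrite !gt_eqF.
by rewrite ler_pM2l// ler_pdivrMl.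
Unshelve. all: by end_near. Qed.

(* With T the inverse of the differential at x0, h x = x - f x T is a
   contraction near x0, and f x = y iff x is a fixed point of P x = h x + y T;
   the fixed point is found by minimising |x - P x| on a closed ball. *)
Theorem inverse_function f (O : set 'rV[R]_n) x0 : open O -> O x0 ->
  smooth_on O f -> (forall v, 'd f x0 v = 0 -> v = 0) ->
  exists V W g,
    [/\ open V, V x0, V `<=` O & open W] /\
    [/\ f @` V = W, smooth_on W g, forall x, V x -> g (f x) = x &
        forall x v, V x -> 'd f x v = 0 -> v = 0].
Proof.
move=> oO Ox0 fO inj0.
have Ju0 := jac_unit inj0.
set T := invmx (jac f x0).
have Tc := @rV_linear_continuous R n 'rV[R]_n (mulmxr T).
pose h (x : 'rV[R]_n) : 'rV[R]_n := x - f x *m T.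
have hO : smooth_on O h.
  move=> k; apply: Ck_sub => //.
    by apply: (@Ck_linear _ _ _ _ _ idfun); exact: rV_linear_continuous.
  exact: (Ck_lin_comp oO Tc (fO k)).
have dh x v : O x -> 'D_v h x = v - 'd f x v *m T.
  move=> Ox; have df := smooth_diff fO Ox.
  have dfT : derivable (mulmxr T \o f) x v.
    by apply/diff_derivable/differentiable_comp => //; exact: linear_differentiable.
  have dI : derivable (@idfun 'rV[R]_n) x v by exact: derivable_id.
  rewrite (deriveB dI dfT) derive_id.
  by rewrite (derive_lin v Tc df) deriveE.
have dh0 v : 'D_v h x0 = 0 by rewrite dh// jacE mulmxK// subrr.
(* Summing [n] partial derivatives of size [e] gives a Lipschitz constant at most 1/2 for [h];
   [n.+1] keeps [e] positive when n = 0. *)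
pose e : R := (2 * n.+1%:R)^-1.
have e0 : 0 < e by rewrite invr_gt0 mulr_gt0.
have [r r0 Br] : exists2 r, 0 < r & forall x, `|x - x0| <= r ->
    O x /\ forall j, `|'D_(delta_mx 0 j) h x| <= e.
  have : \forall x \near x0, O x /\ forall j, `|'D_(delta_mx 0 j) h x| <= e.
    near=> x; split; first by near: x; exact: open_near oO Ox0.
    near: x; apply: filter_forall => j.
    have /cvgr_norm_le : {for x0, continuous ('D_(delta_mx 0 j) h)}.
      by apply: smooth_continuous Ox0; exact: smooth_derive.
    by apply; rewrite dh0 normr0.
  move=> /nbhs_normP[/= d d0 dB]; exists (d / 2); first by rewrite divr_gt0.
  move=> x xr; apply: dB => /=; rewrite distrC; apply: le_lt_trans xr _.
  by rewrite ltr_pdivrMr// mulr_natr mulr2n ltrDl.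
have Dh x v : `|x - x0| <= r -> `|'D_v h x| <= 2^-1 * `|v|.
  move=> /Br[Ox De].
  have dhx := smooth_diff hO Ox.
  rewrite (deriveE v dhx) (diff_rV v dhx).
  apply: le_trans (ler_norm_sum _ _ _) _.
  apply: (@le_trans _ _ (\sum_(j < n) `|v| * e)).
    apply: ler_sum => j _; rewrite normrZ; apply: ler_pM => //.
    exact: rV_coord_le.
  rewrite sumr_const card_ord -[_ *+ n]mulr_natr mulrC mulrCA mulrC.
  apply: ler_wpM2r => //.
  rewrite /e invfM mulrCA ler_piMr ?invr_ge0// ler_pdivrMr// mul1r.
  by rewrite ler_nat.
have conv a b t : `|a - x0| <= r -> `|b - x0| <= r -> 0 <= t <= 1 ->
    `|a + t *: (b - a) - x0| <= r.
  move=> ar br t01; apply: le_trans (norm_segment_le x0 a b t01) _.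
  by rewrite ge_max ar br.
have hlip a b : `|a - x0| <= r -> `|b - x0| <= r ->
    `|h b - h a| <= 2^-1 * `|b - a|.
  move=> ar br; have -> : h b = h (a + (b - a)) by rewrite addrC subrK.
  apply: (@mean_value_le _ _ _ h a (b - a)) => t t01.
    by apply: smooth_diff hO _; have [] := Br _ (conv a b t ar br t01).
  by apply: Dh; exact: conv.
(* As [h] is 1/2-Lipschitz, x - h x = f x T expands distances by at least 1/2. This gives
   injectivity of [f] and the Lipschitz bound for its inverse. *)
have flip a b : `|a - x0| <= r -> `|b - x0| <= r ->
    `|b - a| <= 2 * `|(f b - f a) *m T|.
  move=> ar br; have := hlip a b ar br.
  have -> : (f b - f a) *m T = (b - a) - (h b - h a).
    by rewrite mulmxBl /h; apply/rowP => j; rewrite !mxE; ring.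
  have := lerB_dist (b - a) (h b - h a); lra.
have injB x v : `|x - x0| <= r -> 'd f x v = 0 -> v = 0.
  move=> xr fv; have := Dh x v xr; rewrite dh ?fv ?mul0mx ?subr0; last first.
    by have [] := Br x xr.
  move=> vv; apply/eqP; rewrite -normr_le0; have := normr_ge0 v; lra.
(* With radius r/2 here and constant 1/2 for [h], the map [P] below sends the closed r-ball into the
   open one, so its fixed point lies in [V]. *)
pose W := [set y | `|(y - f x0) *m T| < r / 2].
have oW : open W.
  rewrite openE => y Wy.
  have yc : {for y, continuous (fun y : 'rV[R]_n => y - f x0)}.
    by apply: continuousB => //; exact: cst_continuous.
  have yTc : {for y, continuous (mulmxr T \o (fun y : 'rV[R]_n => y - f x0))}.
    exact: continuous_comp yc (Tc _).
  exact: (near_norm_lt yTc Wy).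
have Wf0 : W (f x0) by rewrite /W/= subrr mul0mx normr0 divr_gt0.
pose V := [set x | `|x - x0| < r] `&` (O `&` f @^-1` W).
have oV : open V.
  apply: openI.
    rewrite (_ : [set x | _] = ball x0 r); first exact: ball_open.
    by rewrite -ball_normE; apply/seteqP; split => x /=; rewrite distrC.
  rewrite openE => x [Ox Wfx]; apply: filterI; first exact: open_near oO Ox.
  exact: (smooth_continuous fO Ox) (open_near oW Wfx).
have Vr x : V x -> `|x - x0| <= r by case=> /ltW.
have Vx0 : V x0 by split; rewrite /= ?subrr ?normr0.
have fiber y : W y -> exists x, V x /\ f x = y.
  move=> Wy; pose P (x : 'rV[R]_n) : 'rV[R]_n := h x + y *m T.
  have PB x : `|x - x0| <= r -> `|P x - x0| < r.
    move=> xr; have x0r : `|x0 - x0| <= r by rewrite subrr normr0 ltW.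
    have -> : P x - x0 = (h x - h x0) + (y - f x0) *m T.
      by rewrite /P /h mulmxBl; apply/rowP => j; rewrite !mxE; ring.
    apply: le_lt_trans (ler_normD _ _) _.
    have := hlip _ _ x0r xr; have : `|(y - f x0) *m T| < r / 2 := Wy.
    lra.
  have Pc x : `|x - x0| <= r -> {for x, continuous (fun x : 'rV[R]_n => `|x - P x|)}.
    move=> /Br[Ox _]; have hc := smooth_continuous hO Ox.
    have Px : {for x, continuous (fun x : 'rV[R]_n => x - P x)}.
      apply: continuousB; first by [].
      by apply: continuousD; [exact: hc|exact: cst_continuous].
    exact: (continuous_comp Px (@norm_continuous _ _ _)).
  have [|||c] := @EVT_min_rV R n (fun x : 'rV[R]_n => `|x - P x|)
      (closed_ball x0 r).
  - by exists x0; exact: closed_ballxx.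
  - apply: bounded_closed_compact; last exact: closed_ball_closed.
    exists (`|x0| + r); split; first exact: num_real.
    move=> M /ltW xM x /=; rewrite closed_ballE// /closed_ball_/= distrC => xr.
    apply: le_trans xM; rewrite -{1}(subrK x0 x) addrC.
    by rewrite (le_trans (ler_normD _ _))// lerD2l.
  - apply: continuous_in_subspaceT => x; rewrite inE closed_ballE//.
    by rewrite /closed_ball_/= distrC; exact: Pc.
  rewrite inE closed_ballE// /closed_ball_/= distrC => cr cmin.
  have Pcr := PB c cr.
  (* Minimality at [c] is tested at [P c]; since [P] halves distances, |c - P c| <= |c - P c| / 2,
     hence c = P c. *)
  have : `|c - P c| <= `|P c - P (P c)|.
    apply: (cmin (P c)); apply/mem_set.
    by rewrite /closed_ball_/= distrC ltW.
  have : `|P (P c) - P c| <= 2^-1 * `|P c - c|.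
    have PP a b : P a - P b = h a - h b by rewrite /P opprD addrACA subrr addr0.
    by rewrite PP; exact: hlip cr (ltW Pcr).
  rewrite distrC (distrC (P c) c) => le1 le2.
  have cP : c = P c.
    apply/eqP; rewrite -subr_eq0 -normr_le0; lra.
  exists c; suff fcy : f c = y.
    split=> //; split; first by rewrite /= {1}cP.
    by have [Oc _] := Br c cr; split=> //=; rewrite fcy.
  move: cP; rewrite /P /h => /eqP; rewrite -subr_eq0 => /eqP cP.
  have : (f c - y) *m T = 0.
    by rewrite -cP mulmxBl; apply/rowP => j; rewrite !mxE; ring.
  move/(congr1 (mulmx^~ (jac f x0))); rewrite mul0mx -mulmxA mulVmx// mulmx1.
  by move/eqP; rewrite subr_eq0 => /eqP.
(* The default [x0] is taken only off [W], where every fibre in [V] is empty. *)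
pose g y := xget x0 [set x | V x /\ f x = y].
have gP y : W y -> V (g y) /\ f (g y) = y.
  by move=> /fiber[x xP]; rewrite /g; case: xgetP => [_ -> //|/(_ x)].
have fK x : V x -> g (f x) = x.
  move=> Vx; have [Vg fg] := gP (f x) Vx.2.2.
  apply/eqP; rewrite -subr_eq0 -normr_le0.
  by have := flip _ _ (Vr _ Vx) (Vr _ Vg); rewrite fg subrr mul0mx normr0 mulr0.
have [k k0 Tk] := linear_lipschitz Tc.
have VJ x : V x -> jac f x \in unitmx.
  by move=> Vx; apply: jac_unit => v; apply: injB; exact: Vr.
have glip y z : W y -> W z -> `|g z - g y| <= 2 * k * `|z - y|.
  move=> Wy Wz; have [Vy fy] := gP y Wy; have [Vz fz] := gP z Wz.
  apply: le_trans (flip _ _ (Vr _ Vy) (Vr _ Vz)) _.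
  rewrite fy fz -mulrA.
  have Tzy := Tk (z - y).
  have two0 : 0 <= 2 :> R by rewrite ler0n.
  exact: ler_wpM2l two0 _ _ Tzy.
have dg y : W y -> differentiable g y /\
    (forall v, 'd g y v = v *m invmx (jac f (g y))).
  move=> Wy; have [Vy _] := gP y Wy.
  exact: (inverse_differentiable oW Wy
    (smooth_diff fO Vy.2.1) (VJ _ Vy) (fun z Wz => (gP z Wz).2)
    (fun z => glip y z Wy)).
exists V, W, g; split.
  by split=> // x [_ []].
split.
- apply/seteqP; split=> [_ [x [_ [_ Wx]] <-] //|y Wy].
  by exists (g y); have [] := gP y Wy.
- refine (inverse_smooth oV oW _ _ _ _ _).
  + by apply: smooth_subset fO => x [_ []].
  + by move=> y /gP[].
  + by move=> y /dg[].
  + by move=> y /gP[/VJ].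
  + by move=> y v /dg[].
- exact: fK.
- by move=> x v /Vr; exact: injB.
Unshelve. all: by end_near. Qed.

End Inverse_function.

(** * Symmetry of second derivatives *)

Section Second_derivatives.
Context {R : realType} {n : nat}.
Implicit Types (f : 'rV[R]_n -> R) (x v w : 'rV[R]_n).

Lemma derive_lincomb (V : normedModType R) m (c : 'I_m -> R)
    (F : 'I_m -> V -> R) (y u : V) :
  (forall i, differentiable (F i) y) ->
  'D_u (fun z => \sum_i c i * F i z) y = \sum_i c i * 'D_u (F i) y.
Proof.
move=> dF.
have -> : (fun z => \sum_i c i * F i z) = \sum_i (c i *: F i).
  by apply/funext => z; rewrite fct_sumE.
rewrite derive_sum; last by move=> i; exact/derivableZ/diff_derivable.
by apply: eq_bigr => i _; rewrite deriveZ//; exact: diff_derivable.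
Qed.

Lemma derive_shiftr (V W : normedModType R) (f : V -> W) a b u :
  'D_u (fun y => f (y + b)) a = 'D_u f (a + b).
Proof.
rewrite /derive; set F := fun h => _; set G := fun h => _.
suff -> : F = G by [].
by apply/funext => h; rewrite /F /G /= addrA.
Qed.

Lemma differentiable_shiftr (V W : normedModType R) (f : V -> W) a b :
  differentiable f (a + b) -> differentiable (fun y => f (y + b)) a.
Proof.
move=> df.
have dk : differentiable (cst b : V -> V) a by [].
have di : differentiable (@idfun V) a by [].
have ds : differentiable (idfun + cst b : V -> V) a by exact: differentiableD.
exact: (@differentiable_comp _ _ _ _ (idfun + cst b : V -> V) f).
Qed.

(** Two mean value theorems: along t v for the increment of [f] by t w, then along t w for ['D_v f].
    The intermediate points stay in the parallelogram assumed to lie in [O]. *)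
Lemma second_difference (O : set 'rV[R]_n) f x v w t : smooth_on O f ->
  (forall a b : R, 0 <= a <= 1 -> 0 <= b <= 1 ->
     O (x + a *: (t *: v) + b *: (t *: w))) ->
  exists a b : R, [/\ 0 <= a <= 1, 0 <= b <= 1 &
    f (x + t *: v + t *: w) - f (x + t *: v) - (f (x + t *: w) - f x) =
    t * (t * 'D_w ('D_v f) (x + a *: (t *: v) + b *: (t *: w)))].
Proof.
move=> fO xO.
have i0 : 0 <= (0 : R) <= 1 by rewrite lexx ler01.
have i1 : 0 <= (1 : R) <= 1 by rewrite lexx ler01.
have d1 (a : R) : 0 <= a <= 1 -> differentiable f (x + a *: (t *: v) + t *: w).
  by move=> /xO /(_ i1); rewrite scale1r; exact: smooth_diff.
have d0 (a : R) : 0 <= a <= 1 -> differentiable f (x + a *: (t *: v)).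
  by move=> /xO /(_ i0); rewrite scale0r addr0; exact: smooth_diff.
have [|a /andP[a0 a1]] := @mvt_line R _ (fun y => f (y + t *: w) - f y) x (t *: v).
  move=> a a01; apply: (@differentiableB _ _ _ (fun y => f (y + t *: w)) f).
    by apply: differentiable_shiftr; exact: d1.
  exact: d0.
have a01 : 0 <= a <= 1 by rewrite !ltW.
rewrite (@deriveB _ _ _ (fun y => f (y + t *: w)) f); last 2 first.
- by apply/diff_derivable/differentiable_shiftr/d1.
- exact/diff_derivable/d0.
rewrite (derive_shiftr f).
rewrite (deriveZv _ _ (d1 a a01)) (deriveZv _ _ (d0 a a01)) -scalerBr => ->.
have dD (b : R) : 0 <= b <= 1 ->
    differentiable ('D_v f) (x + a *: (t *: v) + b *: (t *: w)).
  by move=> /(xO _ _ a01); exact: smooth_diff (smooth_derive _ fO).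
have [b /andP[b0 b1] ->] := mvt_line dD.
have b01 : 0 <= b <= 1 by rewrite !ltW.
exists a, b; split => //.
by rewrite (deriveZv _ _ (dD b b01)).
Qed.

(* Both mixed derivatives, taken at points close to x, are equal to the same
   second difference divided by t^2. *)
Lemma schwarz (O : set 'rV[R]_n) f x v w : open O -> O x -> smooth_on O f ->
  'D_v ('D_w f) x = 'D_w ('D_v f) x.
Proof.
move=> oO Ox fO; apply/eqP; rewrite -subr_eq0 -normr_le0.
apply/ler_addgt0Pl => e e0; rewrite addr0.
have cvw := smooth_continuous (smooth_derive v (smooth_derive w fO)) Ox.
have cwv := smooth_continuous (smooth_derive w (smooth_derive v fO)) Ox.
have e20 : 0 < e / 2 by rewrite divr_gt0.
have [d /= d0 dB] : exists2 d, 0 < d & forall y, `|y - x| < d ->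
    [/\ O y, `|'D_v ('D_w f) x - 'D_v ('D_w f) y| < e / 2 &
        `|'D_w ('D_v f) x - 'D_w ('D_v f) y| < e / 2].
  have : \forall y \near x,
      [/\ O y, `|'D_v ('D_w f) x - 'D_v ('D_w f) y| < e / 2 &
        `|'D_w ('D_v f) x - 'D_w ('D_v f) y| < e / 2].
    have n1 := open_near oO Ox.
    have n2 := @near_dist_lt R _ _ _ x (e / 2) cvw e20.
    have n3 := @near_dist_lt R _ _ _ x (e / 2) cwv e20.
    by apply: filterS3 n1 n2 n3 => y h1 h2 h3; exact: And3 h1 h2 h3.
  move=> /nbhs_normP[/= d d0 dB]; exists d; first exact: d0.
  by move=> y yd; apply: dB; rewrite /= distrC.
(* The summand 1 keeps [m] positive when v = w = 0; t m < d then places the parallelogram inside the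
   ball of radius [d]. *)
pose m := `|v| + `|w| + 1.
have m0 : 0 < m by rewrite /m; have := normr_ge0 v; have := normr_ge0 w; lra.
pose t := d / (2 * m).
have t0 : 0 < t by rewrite divr_gt0// mulr_gt0.
have tm : t * m < d.
  by rewrite /t invfM mulrA divfK ?gt_eqF// ltr_pdivrMr// ltr_pMr// ltr1n.
have mE : `|v| + `|w| + 1 = m by [].
clearbody t m.
have small (a b : R) v' w' : `|v'| + `|w'| + 1 = m ->
    0 <= a <= 1 -> 0 <= b <= 1 ->
    `|x + a *: (t *: v') + b *: (t *: w') - x| < d.
  move=> vwm /andP[a0 a1] /andP[b0 b1]; apply: le_lt_trans tm.
  rewrite addrAC [x + _]addrC addrK.
  apply: le_trans (ler_normD _ _) _; rewrite !normrZ !ger0_norm// ?(ltW t0)//.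
  have : a * (t * `|v'|) <= t * `|v'| by rewrite ler_piMl// mulr_ge0// ltW.
  have : b * (t * `|w'|) <= t * `|w'| by rewrite ler_piMl// mulr_ge0// ltW.
  by rewrite -vwm !mulrDr; move: t0; lra.
have [|a [b [a01 b01 e1]]] := @second_difference O f x v w t fO.
  by move=> a b a01 b01; have [] := dB _ (small a b v w mE a01 b01).
have wvm : `|w| + `|v| + 1 = m by rewrite (addrC `|w|).
have [|a' [b' [a'01 b'01 e2]]] := @second_difference O f x w v t fO.
  by move=> a' b' a'01 b'01; have [] := dB _ (small a' b' w v wvm a'01 b'01).
have [_ _ h1] := dB _ (small a b v w mE a01 b01).
have [_ h2 _] := dB _ (small a' b' w v wvm a'01 b'01).
have e12 : 'D_w ('D_v f) (x + a *: (t *: v) + b *: (t *: w)) =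
           'D_v ('D_w f) (x + a' *: (t *: w) + b' *: (t *: v)).
  have tn0 : t != 0 by rewrite gt_eqF.
  apply: (mulfI tn0); apply: (mulfI tn0).
  refine (etrans (esym e1) (etrans _ e2)).
  by rewrite [x + t *: w + _]addrAC; ring.
move: h1 h2; rewrite e12; move: ('D_v ('D_w f) (x + _ + _)) => s.
move: ('D_w ('D_v f) x) ('D_v ('D_w f) x) => p q.
clear -e; rewrite !ltr_norml ler_norml => /andP[h1 h2] /andP[h3 h4].
by apply/andP; split; lra.
Qed.

End Second_derivatives.

(** * One-forms and their exterior derivative *)

Section Scalar.
Context {R : realType} {n : nat}.
Implicit Types (a : 'rV[R]_n -> R).

Lemma scalar_form_sum a v : scalar a -> a v = \sum_j v 0 j * a (delta_mx 0 j).
Proof.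
move=> al.
pose aM := GRing.isLinear.Build _ _ _ _ a al.
pose aL : {linear 'rV[R]_n -> R} := HB.pack a aM.
exact: (rV_linear_sum aL v).
Qed.

Lemma scalar_form0 a : scalar a -> a 0 = 0.
Proof.
by move=> /scalar_form_sum ->; apply: big1 => j _; rewrite mxE mul0r.
Qed.

Lemma scalar_formZ a c v : scalar a -> a (c *: v) = c * a v.
Proof. by move=> al; rewrite -[c *: v]addr0 al scalar_form0// addr0. Qed.

Lemma scalar_formD a u v : scalar a -> a (u + v) = a u + a v.
Proof. by move=> al; rewrite -[u]scale1r al mul1r scale1r. Qed.

End Scalar.

Section Forms.
Context {R : realType}.

Definition one_form {n} (O : set 'rV[R]_n) (A : 'rV[R]_n -> 'rV[R]_n -> R) :=
  (forall x, O x -> scalar (A x)) /\ (forall v, smooth_on O (A ^~ v)).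

(** The vectors stand for constant fields, which commute, so the Cartan formula has no bracket
    term. *)
Definition dform {n} (A : 'rV[R]_n -> 'rV[R]_n -> R) x v w : R :=
  'D_v (A ^~ w) x - 'D_w (A ^~ v) x.

Definition pullback {m n} (f : 'rV[R]_m -> 'rV[R]_n)
  (A : 'rV[R]_n -> 'rV[R]_n -> R) x v : R := A (f x) ('d f x v).

Lemma one_form_subset n (O O' : set 'rV[R]_n) A : O' `<=` O ->
  one_form O A -> one_form O' A.
Proof.
move=> O'O [lA sA]; split=> [x /O'O /lA //|v]; exact: smooth_subset O'O (sA v).
Qed.

Lemma derive_form n (O : set 'rV[R]_n) A x u w : open O -> O x ->
  one_form O A ->
  'D_u (A ^~ w) x = \sum_j w 0 j * 'D_u (A ^~ (delta_mx 0 j)) x.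
Proof.
move=> oO Ox [lA sA].
rewrite -(derive_lincomb (fun j => w 0 j) (F := fun j => A ^~ (delta_mx 0 j))).
  apply: near_eq_derive; apply: filterS (open_near oO Ox) => y /lA Ay.
  exact: scalar_form_sum.
by move=> j; apply: smooth_diff (sA _) Ox.
Qed.

Lemma derive_formv n (O : set 'rV[R]_n) A x u w : open O -> O x ->
  one_form O A ->
  'D_u (A ^~ w) x = \sum_j u 0 j * 'D_(delta_mx 0 j) (A ^~ w) x.
Proof.
move=> oO Ox [lA sA]; have dA := smooth_diff (sA w) Ox.
by rewrite (deriveE _ dA) (diff_rV _ dA).
Qed.

Lemma one_form_derive n (O : set 'rV[R]_n) A u : open O ->
  one_form O A -> one_form O (fun x w => 'D_u (A ^~ w) x).
Proof.
move=> oO fA; split=> [x Ox c v w|w]; last exact: smooth_derive (fA.2 w).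
rewrite !(derive_form u _ oO Ox fA) mulr_sumr -big_split /=.
by apply: eq_bigr => j _; rewrite !mxE mulrDl mulrA.
Qed.

Lemma dform_lin1 n (O : set 'rV[R]_n) A x w : open O -> O x ->
  one_form O A -> scalar (fun v => dform A x v w).
Proof.
move=> oO Ox fA c u v; rewrite /dform; have dA := smooth_diff (fA.2 w) Ox.
rewrite (deriveDv _ _ dA) (deriveZv _ _ dA).
have [l _] := one_form_derive w oO fA; rewrite l//=.
by rewrite /GRing.scale/=; ring.
Qed.

Lemma dform_antisym n (A : 'rV[R]_n -> 'rV[R]_n -> R) x v w :
  dform A x v w = - dform A x w v.
Proof. by rewrite /dform opprB. Qed.

Lemma pullback_sum m n (f : 'rV[R]_m -> 'rV[R]_n) A x v : scalar (A (f x)) ->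
  differentiable f x ->
  pullback f A x v = \sum_j 'D_v f x 0 j * A (f x) (delta_mx 0 j).
Proof. by move=> lA df; rewrite /pullback scalar_form_sum// deriveE. Qed.

Lemma one_form_pullback m n (O : set 'rV[R]_m) (O' : set 'rV[R]_n) f A :
  open O -> open O' -> (forall x, O x -> O' (f x)) -> smooth_on O f ->
  one_form O' A -> one_form O (pullback f A).
Proof.
move=> oO oO' fOO' fO [lA sA]; split=> [x Ox c u v|v k].
  by rewrite /pullback linearP; apply: lA; exact: fOO'.
apply: (@Ck_ext _ _ _ _ _ (fun x => \sum_j
    'D_v f x 0 j * (A ^~ (delta_mx 0 j) \o f) x)) => //.
  move=> x Ox; rewrite pullback_sum//; first exact/lA/fOO'.
  exact: smooth_diff fO Ox.
apply: Ck_sum => // j; apply: Ck_mul => //.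
  by apply: Ck_coord => //; exact: smooth_derive fO k.
exact: (Ck_comp oO fOO' (fO k) (sA _ k)).
Qed.

Lemma derive_coord m n (f : 'rV[R]_m -> 'rV[R]_n) x v j : differentiable f x ->
  'D_v f x 0 j = 'D_v (fun y => f y 0 j) x.
Proof. by move=> df; rewrite (derive_mx (@diff_derivable _ _ _ _ _ v df)) mxE. Qed.

(** In coordinates the Leibniz rule produces second derivatives of [f]; these are symmetric by
    [schwarz] and cancel in the antisymmetrisation. *)
Lemma dform_pullback m n (O : set 'rV[R]_m) (O' : set 'rV[R]_n) f A x v w :
  open O -> open O' -> (forall y, O y -> O' (f y)) -> smooth_on O f ->
  one_form O' A -> O x ->
  dform (pullback f A) x v w = dform A (f x) ('d f x v) ('d f x w).
Proof.
move=> oO oO' fOO' fO fA Ox; have [lA sA] := fA.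
have O'fx := fOO' x Ox; have df := smooth_diff fO Ox.
have fj j : smooth_on O (fun y => f y 0 j).
  by move=> k; apply: Ck_coord (fO k).
have D u t : 'D_u (pullback f A ^~ t) x = \sum_j
    ('D_u ('D_t (fun y => f y 0 j)) x * A (f x) (delta_mx 0 j)
     + 'd f x t 0 j * 'D_('d f x u) (A ^~ (delta_mx 0 j)) (f x)).
  have dj j : differentiable ('D_t (fun y => f y 0 j)) x.
    exact: smooth_diff (smooth_derive t (fj j)) Ox.
  have dAj j : differentiable (A ^~ (delta_mx 0 j)) (f x).
    exact: smooth_diff (sA _) O'fx.
  have dAf j : differentiable (A ^~ (delta_mx 0 j) \o f) x.
    exact: differentiable_comp.
  have -> : 'D_u (pullback f A ^~ t) x = 'D_u (\sum_j
      ('D_t (fun y => f y 0 j) * (A ^~ (delta_mx 0 j) \o f))) x.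
    apply: near_eq_derive; apply: filterS (open_near oO Ox) => y Oy.
    have dfy := smooth_diff fO Oy.
    rewrite pullback_sum//; last exact/lA/fOO'.
    by rewrite fct_sumE; apply: eq_bigr => j _; rewrite derive_coord.
  rewrite derive_sum; last first.
    by move=> j; apply: derivableM; exact: diff_derivable.
  apply: eq_bigr => j _; rewrite deriveM; [|exact: diff_derivable..].
  rewrite -derive_coord// (deriveE t df) addrC; congr (_ + _).
    by rewrite /GRing.scale/= mulrC.
  rewrite /GRing.scale/= (deriveE u (dAf j)) (diff_comp df (dAj j)) /=.
  by rewrite (deriveE _ (dAj j)).
rewrite /dform !D (derive_form _ _ oO' O'fx fA).
rewrite (derive_form _ ('d f x v) oO' O'fx fA) -!sumrB; apply: eq_bigr => j _.
by rewrite (schwarz v w oO Ox (fj j)) opprD addrACA subrr add0r.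
Qed.

End Forms.

(** * The Poincare lemma *)

Section Integral.
Context {R : realType}.
Let mu := @lebesgue_measure R.

Definition unit_integral (c : R -> R) : R := \int[mu]_(t in `[0, 1]) c t.

Lemma antiderivative (c : R -> R) :
  (forall t : R, 0 <= t <= 1 -> {for t, continuous c}) ->
  exists P : R -> R, [/\ P 0 = 0, P 1 = unit_integral c,
    forall t : R, 0 < t < 1 -> is_derive t 1 P (c t) &
    {within `[0, 1], continuous P}].
Proof.
move=> cc.
have ci : mu.-integrable `[0, 1] (EFin \o c).
  apply: continuous_compact_integrable; first exact: segment_compact.
  by apply: continuous_in_subspaceT => t; rewrite inE/= in_itv/=; exact: cc.
exists (fun t => \int[mu]_(s in `[0, t]) c s); split => //.
- by rewrite set_itv1 Rintegral_set1.
- move=> t /andP[t0 t1].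
  have ct : {for t, continuous c} by apply: cc; rewrite !ltW.
  have [dF dFE] := continuous_FTC1_closed t1 ci t0 ct.
  apply: DeriveDef; first exact: dF.
  by rewrite -derive1E; exact: dFE.
- exact: parameterized_integral_continuous ler01 ci.
Qed.

(** A substitute for differentiation under the integral sign: the mean value theorem, applied to the
    difference of the antiderivatives and [q], reduces an estimate of integrals to one of integrands
    at a single parameter. *)
Lemma unit_integral_mvt (c1 c2 q dq : R -> R) :
  (forall t : R, 0 <= t <= 1 -> {for t, continuous c1}) ->
  (forall t : R, 0 <= t <= 1 -> {for t, continuous c2}) ->
  (forall t : R, 0 <= t <= 1 -> is_derive t 1 q (dq t)) ->
  exists2 t : R, 0 < t < 1 &
    unit_integral c1 - unit_integral c2 - (q 1 - q 0) = c1 t - c2 t - dq t.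
Proof.
move=> /antiderivative[P1 [P10 P11 dP1 P1c]] /antiderivative[P2 [P20 P21 dP2 P2c]] dqq.
have [|| t + E] := @MVT R (P1 - P2 - q) (fun t => c1 t - c2 t - dq t) 0 1 ltr01.
- move=> t; rewrite in_itv/= => /andP[t0 t1].
  have t01 : 0 < t < 1 by rewrite t0.
  have t01' : 0 <= t <= 1 by rewrite !ltW.
  exact: (is_deriveB (is_deriveB (dP1 t t01) (dP2 t t01)) (dqq t t01')).
- apply: within_continuousB; first exact: within_continuousB P1c P2c.
  apply: derivable_within_continuous => t; rewrite in_itv/= => t01.
  by have [] := dqq t t01.
rewrite in_itv/= => t01; exists t => //.
move: E; rewrite subr0 mulr1 => <-.
rewrite -[RHS]/(P1 1 - P2 1 - q 1 - (P1 0 - P2 0 - q 0)) P11 P21 P10 P20.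
by ring.
Qed.
End Integral.

(** * Uniform bounds on derivatives of forms, and the primitive of a closed form *)

Section Poincare.
Context {R : realType}.

(** The first mean value theorem gives ['D_k f] at a + s k, the second compares it with its value at
    [a]; the factor s in (0, 1) from the second is simply dropped. *)
Lemma taylor2_le (V : normedModType R) (O : set V) (f : V -> R) a k M :
  smooth_on O f -> (forall t : R, 0 <= t <= 1 -> O (a + t *: k)) ->
  (forall t : R, 0 <= t <= 1 -> `|'D_k ('D_k f) (a + t *: k)| <= M) ->
  `|f (a + k) - f a - 'D_k f a| <= M.
Proof.
move=> fO aO fM.
have df (t : R) : 0 <= t <= 1 -> differentiable f (a + t *: k).
  by move=> /aO; exact: smooth_diff.
have [s /andP[s0 s1] ->] := mvt_line df.
have ss t : 0 <= t <= 1 -> 0 <= t * s <= 1.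
  move=> /andP[t0 t1]; rewrite mulr_ge0 ?(ltW s0)//=.
  by rewrite mulr_ile1// ltW.
have dDf (t : R) : 0 <= t <= 1 -> differentiable ('D_k f) (a + t *: (s *: k)).
  move=> /ss t01; rewrite scalerA.
  exact: smooth_diff (smooth_derive k fO) (aO _ t01).
have [t /andP[t0 t1] ->] := mvt_line dDf.
have t01 : 0 <= t <= 1 by rewrite !ltW.
rewrite (deriveZv _ _ (dDf t t01)) scalerA normrZ (gtr0_norm s0).
by apply: le_trans (fM _ (ss t t01)); rewrite ler_piMl// ltW.
Qed.

Lemma near_finite_forall (V : normedModType R) (I : finType)
    (P : I -> V -> Prop) (x : V) :
  (forall i, \forall y \near x, P i y) -> \forall y \near x, forall i, P i y.
Proof. by move=> xP; apply: filter_forall => i; exact: xP. Qed.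

Lemma near_finite_bound (V : normedModType R) (I : finType) (F : I -> V -> R) x :
  (forall i, {for x, continuous (F i)}) ->
  \forall y \near x, forall i, `|F i y| <= `|F i x| + 1.
Proof.
move=> Fc; apply: filter_forall => i.
have x1 : `|F i x| < `|F i x| + 1 by rewrite ltrDl.
by apply: filterS (near_norm_lt (Fc i) x1) => y /ltW.
Qed.

Lemma ler_norm_lincomb n (c : 'I_n -> R) (F K : 'I_n -> R) M :
  (forall i, `|c i| <= M) -> (forall i, `|F i| <= K i) ->
  `|\sum_i c i * F i| <= (\sum_i K i) * M.
Proof.
move=> cM FK; apply: le_trans (ler_norm_sum _ _ _) _.
rewrite mulr_suml; apply: ler_sum => i _.
by rewrite normrM mulrC; apply: ler_pM.
Qed.

(** The expression is bilinear in [h] and [u] with finitely many continuous coefficients, so one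
    constant serves all vectors and all points near [x]. *)
Lemma form_derive_bound n (O : set 'rV[R]_n) A x : open O -> O x ->
  one_form O A ->
  exists K, \forall y \near x, forall h u, `|'D_h (A ^~ u) y| <= K * `|h| * `|u|.
Proof.
move=> oO Ox fA.
pose F (ij : 'I_n * 'I_n) := 'D_(delta_mx 0 ij.1) (A ^~ (delta_mx 0 ij.2)).
have Fc ij : {for x, continuous (F ij)}.
  exact: smooth_continuous (smooth_derive _ (fA.2 _)) Ox.
exists (\sum_j \sum_i (`|F (i, j) x| + 1)).
apply: filterS2 (open_near oO Ox) (near_finite_bound Fc) => y Oy Fy h u.
rewrite (derive_form _ _ oO Oy fA) -mulrA mulr_suml.
apply: le_trans (ler_norm_sum _ _ _) _; apply: ler_sum => j _.
rewrite (derive_formv _ _ oO Oy fA) normrM [leRHS]mulrA [leRHS]mulrC.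
apply: ler_pM => //; first exact: rV_coord_le.
by apply: ler_norm_lincomb => i; [exact: rV_coord_le|exact: (Fy (i, j))].
Qed.

(** The partial derivatives of a one-form are again one-forms; the previous bound applies to each of
    them, and [k] is expanded in coordinates. *)
Lemma form_derive2_bound n (O : set 'rV[R]_n) A x : open O -> O x ->
  one_form O A ->
  exists K, \forall y \near x, forall h k u,
    `|'D_h ('D_k (A ^~ u)) y| <= K * `|h| * `|u| * `|k|.
Proof.
move=> oO Ox fA.
pose Ai (i : 'I_n) := fun x w => 'D_(delta_mx 0 i) (A ^~ w) x.
have fAi i : one_form O (Ai i) by exact: one_form_derive.
have /choice[K KP] i := form_derive_bound oO Ox (fAi i).
exists (\sum_i K i).
have nK := near_finite_forall KP.
apply: filterS2 (open_near oO Ox) nK => y Oy Ky h k u.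
have -> : 'D_h ('D_k (A ^~ u)) y = \sum_i k 0 i * 'D_h (Ai i ^~ u) y.
  rewrite -derive_lincomb; last by move=> i; exact: smooth_diff ((fAi i).2 u) Oy.
  apply: near_eq_derive; apply: filterS (open_near oO Oy) => z Oz.
  exact: (derive_formv _ _ oO Oz fA).
have -> : (\sum_i K i) * `|h| * `|u| = \sum_i (K i * `|h| * `|u|).
  by rewrite !mulr_suml.
by apply: ler_norm_lincomb => i; [exact: rV_coord_le|exact: Ky].
Qed.

(* G z is the integral of C along the segment from z0 to z.  By closedness the
   first-order part of G (z + h) - G z is the integral of the derivative of
   t |-> t C (z0 + t (z - z0)) h, which is C z h; the mean value theorem and the
   bounds on the first two derivatives of C show that the rest is O (|h|^2). *)
Lemma poincare n (O : set 'rV[R]_n) C z0 : open O -> O z0 -> one_form O C ->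
  (forall x v w, O x -> dform C x v w = 0) ->
  exists r G, [/\ 0 < r, ball z0 r `<=` O, G z0 = 0, smooth_on (ball z0 r) G &
    forall z v, ball z0 r z -> 'd G z v = C z v].
Proof.
move=> oO Oz0 fC dC.
have [K1 b1] := form_derive_bound oO Oz0 fC.
have [K2 b2] := form_derive2_bound oO Oz0 fC.
have [r r0 Br] : exists2 r, 0 < r & forall y, `|y - z0| < r -> [/\ O y,
    forall h u, `|'D_h (C ^~ u) y| <= K1 * `|h| * `|u| &
    forall h k u, `|'D_h ('D_k (C ^~ u)) y| <= K2 * `|h| * `|u| * `|k|].
  have : \forall y \near z0, [/\ O y,
    forall h u, `|'D_h (C ^~ u) y| <= K1 * `|h| * `|u| &
    forall h k u, `|'D_h ('D_k (C ^~ u)) y| <= K2 * `|h| * `|u| * `|k|].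
    by apply: filterS3 (open_near oO Oz0) b1 b2 => y h1 h2 h3; exact: And3 h1 h2 h3.
  move=> /nbhs_normP[/= r r0 rB]; exists r; first exact: r0.
  by move=> y yr; apply: rB; rewrite /= distrC.
have OB y : `|y - z0| < r -> O y by case/Br.
have conv a b (t : R) : `|a - z0| < r -> `|b - z0| < r -> 0 <= t <= 1 ->
    `|a + t *: (b - a) - z0| < r.
  move=> ar br t01; apply: le_lt_trans (norm_segment_le z0 a b t01) _.
  by rewrite gt_max ar br.
have rad z (t : R) : `|z - z0| < r -> 0 <= t <= 1 ->
    `|z0 + t *: (z - z0) - z0| < r.
  by move=> zr; apply: conv => //; rewrite subrr normr0.
pose c z (t : R) := C (z0 + t *: (z - z0)) (z - z0).
have dCline z w (t : R) : `|z - z0| < r -> 0 <= t <= 1 ->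
    is_derive t 1 (fun s : R => C (z0 + s *: (z - z0)) w)
      ('D_(z - z0) (C ^~ w) (z0 + t *: (z - z0))).
  move=> zr t01; apply: (@is_derive_line _ _ _ (C ^~ w)).
  exact: smooth_diff (fC.2 w) (OB _ (rad _ _ zr t01)).
have cc z : `|z - z0| < r ->
    forall t : R, 0 <= t <= 1 -> {for t, continuous (c z)}.
  move=> zr t t01; have [dc _] := dCline z (z - z0) t zr t01.
  by apply: differentiable_continuous; exact/derivable1_diffP.
pose G z := unit_integral (c z).
have Gest z h : `|z - z0| < r -> `|z + h - z0| < r ->
    `|G (z + h) - G z - C z h| <= (K2 * `|z - z0| + K1) * `|h| * `|h|.
  move=> zr zhr.
  (* The increment of [q] over the unit interval is C z h, so the error to be bounded has the shape
     required by [unit_integral_mvt]. *)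
  pose q (t : R) := t * C (z0 + t *: (z - z0)) h.
  pose dq (t : R) := C (z0 + t *: (z - z0)) h +
    t * 'D_(z - z0) (C ^~ h) (z0 + t *: (z - z0)).
  have dqq (t : R) : 0 <= t <= 1 -> is_derive t 1 q (dq t).
    move=> t01; have d1 := dCline z h t zr t01.
    have dI : is_derive t 1 (@idfun R) 1 by exact: is_derive_id.
    apply: (is_derive_eq (is_deriveM dI d1)).
    by rewrite /dq /GRing.scale/= mulr1 addrC.
  have [t /andP[t0 t1] E] := unit_integral_mvt (cc _ zhr) (cc _ zr) dqq.
  have t01 : 0 <= t <= 1 by rewrite !ltW.
  have -> : G (z + h) - G z - C z h = c (z + h) t - c z t - dq t.
    rewrite -E /q mul0r subr0 mul1r scale1r; congr (_ - C _ _).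
    by rewrite addrC subrK.
  pose u := z - z0.
  pose a := z0 + t *: u; pose b := z0 + t *: (z + h - z0).
  have ar : `|a - z0| < r by exact: rad.
  have br : `|b - z0| < r by exact: rad.
  have ba : b = a + t *: h.
    by rewrite /a /b /u; apply/rowP => j; rewrite !mxE; ring.
  have seg (s : R) : 0 <= s <= 1 -> `|a + s *: (t *: h) - z0| < r.
    have -> : t *: h = b - a by rewrite ba addrC addKr.
    exact: conv.
  have Oa : O a by exact: OB.
  have lb : scalar (C b) by exact/fC.1/OB.
  (* Closedness exchanges [u] and [h], so the derivative in [dq] becomes the first-order term of C
     (b) u - C (a) u; what remains is a Taylor remainder in the direction t h. *)
  have closed : 'D_u (C ^~ h) a = 'D_h (C ^~ u) a.
    by apply/eqP; rewrite -subr_eq0; apply/eqP; exact: dC.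
  have -> : c (z + h) t - c z t - dq t =
      (C (a + t *: h) u - C a u - 'D_(t *: h) (C ^~ u) a)
      + (C (a + t *: h) h - C a h).
    rewrite (deriveZv _ _ (smooth_diff (fC.2 u) Oa)) -closed -ba.
    rewrite /c /dq -/u -/a -/b.
    have -> : z + h - z0 = u + h by rewrite /u addrAC.
    by rewrite (scalar_formD _ _ lb) /GRing.scale/=; ring.
  have e1 : `|C (a + t *: h) u - C a u - 'D_(t *: h) (C ^~ u) a| <=
      K2 * `|u| * `|h| * `|h|.
    apply: (taylor2_le (fC.2 u)) => s s01; first exact/OB/seg.
    have [Os _ /(_ (t *: h) (t *: h) u) B2] := Br _ (seg s s01).
    apply: le_trans B2 _; rewrite normrZ (gtr0_norm t0).
    (* [K2] itself has no known sign; the sign of the product is read off the bound it provides. *)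
    have K20 : 0 <= K2 * `|h| * `|u| * `|h|.
      have [_ _ /(_ h h u) B2] := Br a ar.
      exact: le_trans (normr_ge0 _) B2.
    have -> : K2 * (t * `|h|) * `|u| * (t * `|h|) =
      t * t * (K2 * `|h| * `|u| * `|h|) by ring.
    have -> : K2 * `|u| * `|h| * `|h| = K2 * `|h| * `|u| * `|h| by ring.
    by rewrite ler_piMl// mulr_ile1// ltW.
  have e2 : `|C (a + t *: h) h - C a h| <= K1 * `|h| * `|h|.
    have dh (s : R) : 0 <= s <= 1 ->
        differentiable (C ^~ h) (a + s *: (t *: h)).
      by move=> s01; apply: smooth_diff (fC.2 h) _; exact/OB/seg.
    have [s /andP[s0 s1] ->] := mvt_line dh.
    have s01 : 0 <= s <= 1 by rewrite !ltW.
    rewrite (deriveZv _ _ (dh s s01)) normrZ (gtr0_norm t0).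
    have [_ /(_ h h) B1 _] := Br _ (seg s s01).
    by apply: le_trans B1; rewrite ler_piMl// ltW.
  apply: le_trans (ler_normD _ _) _; rewrite -/u.
  have -> : (K2 * `|u| + K1) * `|h| * `|h| =
    K2 * `|u| * `|h| * `|h| + K1 * `|h| * `|h| by ring.
  exact: lerD.
have ballE z : ball z0 r z <-> `|z - z0| < r by rewrite -ball_normE /= distrC.
have dG z : ball z0 r z -> differentiable G z /\ 'd G z = C z :> (_ -> _).
  move=> /ballE zr.
  pose CM := GRing.isLinear.Build _ _ _ _ (C z) (fC.1 z (OB _ zr)).
  pose CL : {linear 'rV[R]_n -> R} := HB.pack (C z) CM.
  apply: (@eps_diff _ _ _ G CL); first exact: rV_linear_continuous.
  move=> e e0.
  pose K := Num.max (K2 * `|z - z0| + K1) 1.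
  have K0 : 0 < K by rewrite lt_max ltr01 orbT.
  have d1 : 0 < r - `|z - z0| by rewrite subr_gt0.
  have d2 : 0 < e / K by rewrite divr_gt0.
  apply: filterS2 (nbhs0_lt d1) (nbhs0_lt d2) => h h1 h2.
  have zhr : `|z + h - z0| < r.
    rewrite addrAC; apply: le_lt_trans (ler_normD _ _) _.
    by rewrite -ltrBrDl.
  rewrite (addrC h); apply: le_trans (Gest z h zr zhr) _.
  apply: ler_wpM2r => //.
  apply: (@le_trans _ _ (K * `|h|)).
    by rewrite ler_wpM2r// le_max lexx.
  by rewrite -ler_pdivlMl// mulrC ltW.
have sG : smooth_on (ball z0 r) G.
  case=> [|k].
    by move=> z /dG[dGz _]; exact: differentiable_continuous.
  split=> [z /dG[]//|v].
  apply: (@Ck_ext _ _ _ _ _ (C ^~ v)); first exact: ball_open.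
    by move=> z /dG[dGz e]; rewrite deriveE// e.
  by apply: Ck_subset (fC.2 v k) => z /ballE /OB.
exists r, G; split => //.
- by move=> z /ballE /OB.
- rewrite /G (_ : c z0 = cst 0).
    by rewrite /unit_integral Rintegral_cst ?mul0r.
  apply/funext => t; rewrite /c subrr scaler0 addr0; apply: scalar_form0.
  exact: fC.1.
- by move=> z v /dG[_ ->].
Qed.

End Poincare.

(** * Lifting a map of the bases to a strict contact map *)

Section Smooth_rows.
Context {R : realType}.

Lemma diff_chain (U V W : normedModType R) (f : U -> V) (g : V -> W) x v :
  differentiable f x -> differentiable g (f x) ->
  'd (g \o f) x v = 'd g (f x) ('d f x v).
Proof. by move=> df dg; rewrite diff_comp. Qed.

Lemma diff_eq_on (V W : normedModType R) (O : set V) (f g : V -> W) x v :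
  open O -> O x -> (forall y, O y -> f y = g y) -> differentiable f x ->
  'd f x v = 'd g x v.
Proof.
move=> oO Ox fg df.
have nfg : \near x, f x = g x by apply: filterS (open_near oO Ox) => y /fg.
by have [_ ->] := near_eq_diff nfg df.
Qed.

Lemma diff_linear m (W : normedModType R) (L : {linear 'rV[R]_m -> W}) x v :
  'd L x v = L v.
Proof. by rewrite diff_lin//; exact: rV_linear_continuous. Qed.

Lemma smooth_linear m (W : normedModType R) (O : set 'rV[R]_m)
    (L : {linear 'rV[R]_m -> W}) :
  smooth_on O L.
Proof. by move=> k; apply: Ck_linear; exact: rV_linear_continuous. Qed.

Lemma linear_diff m (W : normedModType R) (L : {linear 'rV[R]_m -> W}) x :
  differentiable L x.
Proof. by apply: linear_differentiable; exact: rV_linear_continuous. Qed.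

Lemma diff_row_mx l m n (O : set 'rV[R]_l) (f : 'rV[R]_l -> 'rV[R]_m)
    (g : 'rV[R]_l -> 'rV[R]_n) x v : open O -> O x ->
  smooth_on O f -> smooth_on O g ->
  'd (fun y => row_mx (f y) (g y)) x v = row_mx ('d f x v) ('d g x v).
Proof.
move=> oO Ox fO gO.
have rO : smooth_on O (fun y => row_mx (f y) (g y)).
  by move=> k; apply: Ck_row_mx.
have dr := smooth_diff rO Ox.
have df := smooth_diff fO Ox; have dg := smooth_diff gO Ox.
rewrite -!deriveE//; apply/rowP => j; rewrite -[j]splitK derive_coord//.
case: (fintype.split j) => i /=.
  by rewrite row_mxEl derive_coord//; under eq_fun do rewrite row_mxEl.
by rewrite row_mxEr derive_coord//; under eq_fun do rewrite row_mxEr.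
Qed.

Lemma smooth_preimage_open m n (O : set 'rV[R]_m) (B : set 'rV[R]_n) f :
  open O -> open B -> smooth_on O f -> open (O `&` f @^-1` B).
Proof.
move=> oO oB fO; rewrite openE => x [Ox Bfx]; apply: filterI.
  exact: open_near oO Ox.
exact: (smooth_continuous fO Ox) (open_near oB Bfx).
Qed.

Lemma one_formB n (O : set 'rV[R]_n) A B : open O ->
  one_form O A -> one_form O B -> one_form O (fun x v => A x v - B x v).
Proof.
move=> oO [lA sA] [lB sB]; split=> [x Ox a u v|v k].
  by rewrite lA// lB// /GRing.scale/=; ring.
by apply: Ck_sub => //; [exact: sA|exact: sB].
Qed.

Lemma dformB n (O : set 'rV[R]_n) A B x v w : open O -> O x ->
  one_form O A -> one_form O B ->
  dform (fun x v => A x v - B x v) x v w = dform A x v w - dform B x v w.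
Proof.
move=> oO Ox [lA sA] [lB sB]; rewrite /dform.
have D u t : 'D_u (fun y => A y t - B y t) x = 'D_u (A ^~ t) x - 'D_u (B ^~ t) x.
  apply: (@deriveB _ _ _ (A ^~ t) (B ^~ t)).
    exact: diff_derivable (smooth_diff (sA t) Ox).
  exact: diff_derivable (smooth_diff (sB t) Ox).
by rewrite !D; ring.
Qed.

End Smooth_rows.

(** * The fibre product of two projections and the graph inside it *)

Section Lift.
Context {R : realType}.

(** A scalar as a row of length one, so that [row_mx] can stack it with the coordinates of a
    projection. *)
Definition row1 (a : R) : 'rV[R]_1 := scalev 1%:M a.

Lemma row1E a : row1 a = a%:M.
Proof. by rewrite /row1 /scalev scalemx1. Qed.

(** Source and target both have dimension 1 + k, so injectivity of the joint differential suffices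
    for the inverse function theorem. It serves twice: for the straightening, and for solving G = 0
    as a graph. *)
Lemma local_coordinates k (O : set 'rV[R]_(1 + k)) (G : 'rV[R]_(1 + k) -> R)
    (Q : 'rV[R]_(1 + k) -> 'rV[R]_k) x0 :
  open O -> O x0 -> smooth_on O G -> smooth_on O Q ->
  (forall v, 'd G x0 v = 0 -> 'd Q x0 v = 0 -> v = 0) ->
  exists W psi, [/\ open W, smooth_on W psi, W (row_mx (G x0)%:M (Q x0)),
    psi (row_mx (G x0)%:M (Q x0)) = x0 &
    forall w, W w -> [/\ O (psi w), (G (psi w))%:M = lsubmx w &
                         Q (psi w) = rsubmx w]].
Proof.
move=> oO Ox0 sG sQ inj.
have e0 : (1%:M : 'rV[R]_1) != 0.
  by apply/eqP => /matrixP/(_ 0 0); rewrite !mxE; apply/eqP; exact: oner_neq0.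
pose g (x : 'rV[R]_(1 + k)) : 'rV[R]_1 := row1 (G x).
have row1c : continuous (row1 : R -> 'rV[R]_1) by exact: scalel_continuous.
have sg : smooth_on O g.
  by move=> j; exact: (Ck_lin_comp (L := scalev (1%:M : 'rV[R]_1)) oO row1c (sG j)).
have dg v : 'd g x0 v = row1 ('d G x0 v).
  have dG := smooth_diff sG Ox0.
  rewrite -(deriveE v (smooth_diff sg Ox0)) -(deriveE v dG).
  exact: (derive_lin (L := scalev (1%:M : 'rV[R]_1)) v row1c dG).
pose P x := row_mx (g x) (Q x).
have sP : smooth_on O P by move=> j; apply: Ck_row_mx.
have Pinj v : 'd P x0 v = 0 -> v = 0.
  rewrite (diff_row_mx v oO Ox0 sg sQ) dg => /eqP; rewrite row_mx_eq0.
  rewrite /row1 /scalev scaler_eq0 (negPf e0) orbF => /andP[/eqP h1 /eqP h2].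
  exact: inj.
have [V [W [psi [[oV Vx0 VO oW] [PV sW psiK _]]]]] :=
  inverse_function oO Ox0 sP Pinj.
have Px0 : P x0 = row_mx (G x0)%:M (Q x0) by rewrite /P /g row1E.
exists W, psi; split=> //.
- by rewrite -PV -Px0; exists x0.
- by rewrite -Px0; exact: psiK.
- move=> w; rewrite -PV => -[x Vx <-]; rewrite psiK// /P /g row1E.
  by rewrite row_mxKl row_mxKr; split=> //; exact: VO.
Qed.

(* psi straightens the second space along the kernel of 'd Q2, so that
   z = (t, x) |-> (x, L z) parametrises the pairs with Q1 x = Q2 (L z); sig is
   the section x |-> (t x, x) of the hypersurface G = 0, and F = L o sig. *)
Theorem strict_contact_lift k (O1 O2 : set 'rV[R]_(1 + k))
    (Q1 Q2 : 'rV[R]_(1 + k) -> 'rV[R]_k)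
    (A1 A2 : 'rV[R]_(1 + k) -> 'rV[R]_(1 + k) -> R) x1 x2 :
  open O1 -> open O2 -> O1 x1 -> O2 x2 ->
  smooth_on O1 Q1 -> smooth_on O2 Q2 -> one_form O1 A1 -> one_form O2 A2 ->
  Q1 x1 = Q2 x2 ->
  (forall v, A1 x1 v = 0 -> 'd Q1 x1 v = 0 -> v = 0) ->
  (forall v, A2 x2 v = 0 -> 'd Q2 x2 v = 0 -> v = 0) ->
  (forall x y v w v' w', O1 x -> O2 y -> Q1 x = Q2 y ->
     'd Q1 x v = 'd Q2 y v' -> 'd Q1 x w = 'd Q2 y w' ->
     dform A1 x v w = dform A2 y v' w') ->
  exists V W F G,
    [/\ open V, V x1, V `<=` O1, open W & W `<=` O2] /\
    [/\ F @` V = W, smooth_on V F, smooth_on W G, forall x, V x -> G (F x) = x &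
        F x1 = x2] /\
    (forall x, V x -> Q2 (F x) = Q1 x /\
      forall v, A2 (F x) ('d F x v) = A1 x v).
Proof.
move=> oO1 oO2 Ox1 Ox2 sQ1 sQ2 fA1 fA2 Q12 inj1 inj2 star.
have l2 := fA2.1 _ Ox2.
pose aM := GRing.isLinear.Build _ _ _ _ (A2 x2) l2.
(* The form [A2] frozen at [x2], used as a coordinate function. Its differential is [A2 x2], which
   is what [inj2] requires. *)
pose a : {linear 'rV[R]_(1 + k) -> R} := HB.pack (A2 x2) aM.
have ac : continuous a by exact: rV_linear_continuous.
have sa (O : set 'rV[R]_(1 + k)) : smooth_on O a by move=> j; exact: Ck_linear.
have da x v : 'd a x v = A2 x2 v by rewrite diff_lin.
have [|W2 [psi [oW2 spsi W20 psi0 psiP]]] :=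
  local_coordinates oO2 Ox2 (sa O2) sQ2.
  by move=> v; rewrite da; exact: inj2.
pose m := (1 + k)%N.
(* Over (t, x) the point of the second space must have first coordinate t and projection [Q1 x];
   [psi] recovers it from these data. *)
pose lift0 (z : 'rV[R]_(1 + m)) : 'rV[R]_(1 + k) :=
  row_mx (lsubmx z) (Q1 (rsubmx z)).
pose z0 : 'rV[R]_(1 + m) := row_mx (A2 x2 x2)%:M x1.
pose rs : {linear 'rV[R]_(1 + m) -> 'rV[R]_m} := rsubmx.
pose ls : {linear 'rV[R]_(1 + m) -> 'rV[R]_1} := lsubmx.
pose O' : set 'rV[R]_(1 + m) := [set: _] `&` rs @^-1` O1.
have oO' : open O'.
  by apply: smooth_preimage_open => //; [exact: openT|exact: smooth_linear].
have sl : smooth_on O' lift0.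
  move=> j; apply: Ck_row_mx => //; first exact: (smooth_linear O' ls).
  apply: (@Ck_compV _ _ _ _ _ _ O1 rs Q1) => //.
  - by move=> z [].
  - exact: smooth_linear.
pose Oz := O' `&` lift0 @^-1` W2.
have oOz : open Oz by exact: smooth_preimage_open.
have sl' : smooth_on Oz lift0 by apply: smooth_subset sl => z [].
have z0O : Oz z0.
  split; first by split=> //; rewrite /rs/= /z0 row_mxKr.
  by rewrite /lift0/= /z0 row_mxKl row_mxKr Q12.
pose L z := psi (lift0 z).
have sL : smooth_on Oz L.
  by apply: (smooth_comp oOz oW2 _ sl' spsi) => z [].
have LO z : Oz z -> O2 (L z) by move=> [_ /psiP[]].
have La z : Oz z -> (a (L z))%:M = ls z.
  by move=> [_ /psiP[_ -> _]]; rewrite /lift0 row_mxKl.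
have LQ z : Oz z -> Q2 (L z) = Q1 (rs z).
  by move=> [_ /psiP[_ _ ->]]; rewrite /lift0 row_mxKr.
have Oz1 z : Oz z -> O1 (rs z) by move=> [[]].
have L0 : L z0 = x2 by rewrite /L /lift0 /z0 row_mxKl row_mxKr Q12 psi0.
have dL z : Oz z -> differentiable L z by exact: smooth_diff.
(* Differentiating Q2 (L z) = Q1 (rs z) puts ['d L z v] and ['d rs z v] over the same base vector,
   as [star] demands. *)
have dLQ z v : Oz z -> 'd Q1 (rs z) ('d rs z v) = 'd Q2 (L z) ('d L z v).
  move=> Ozz; have dQ2 := smooth_diff sQ2 (LO z Ozz).
  have dQ1 := smooth_diff sQ1 (Oz1 z Ozz).
  refine (etrans _ (diff_chain v (dL z Ozz) dQ2)).
  refine (etrans _ (esym (diff_eq_on v oOz Ozz LQ (differentiable_comp (dL z Ozz) dQ2)))).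
  exact: (esym (diff_chain v (linear_diff rs z) dQ1)).
pose C z v := pullback L A2 z v - pullback rs A1 z v.
have fL : one_form Oz (pullback L A2) by exact: (one_form_pullback oOz oO2 LO sL fA2).
have fr : one_form Oz (pullback rs A1).
  by apply: (one_form_pullback oOz oO1) => //; exact: smooth_linear.
have fC : one_form Oz C by exact: one_formB.
have dC z v w : Oz z -> dform C z v w = 0.
  move=> Ozz; rewrite (dformB v w oOz Ozz fL fr).
  rewrite (dform_pullback v w oOz oO2 LO sL fA2 Ozz).
  rewrite (dform_pullback v w oOz oO1 Oz1 (smooth_linear Oz rs) fA1 Ozz).
  apply/eqP; rewrite subr_eq0 eq_sym; apply/eqP.
  exact: (star _ _ _ _ _ _ (Oz1 z Ozz) (LO z Ozz) (esym (LQ z Ozz))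
            (dLQ z v Ozz) (dLQ z w Ozz)).
have [r [G [r0 BO G0 sG dG]]] := poincare oOz z0O fC dC.
have z0B : ball z0 r z0 by exact: ballxx.
have oB : open (ball z0 r) by exact: ball_open.
have rsz0 : rs z0 = x1 by rewrite /rs/= /z0 row_mxKr.
(* Transversality to G = 0: if the [x]-part of [v] vanishes, [C z0 v] is [A2 x2] of the image of [v]
   under dL, that is the derivative of a (L z), which is the t-component of [v]. *)
have Hinj v : 'd G z0 v = 0 -> 'd rs z0 v = 0 -> v = 0.
  rewrite (diff_linear rs) dG// => Cv rv.
  have Ozz0 := z0O.
  have lsv : ls v = 0.
    pose b : {linear 'rV[R]_(1 + m) -> R} := coord (lshift m 0).
    have Lb z : Oz z -> (a \o L) z = b z.
      by move=> /La /(congr1 (fun M : 'M[R]_1 => M 0 0)); rewrite !mxE.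
    have bv : b v = 0.
      rewrite -(diff_linear b z0).
      have daL := differentiable_comp (dL z0 z0O) (linear_diff a (L z0)).
      refine (etrans (esym (diff_eq_on v oOz z0O Lb daL)) _).
      refine (etrans (diff_chain v (dL z0 z0O) (linear_diff a (L z0))) _).
      refine (etrans (diff_linear a (L z0) ('d L z0 v)) _).
      have A10 : A1 (rs z0) ('d rs z0 v) = 0.
        have -> : 'd rs z0 v = 0 by refine (etrans (diff_linear rs z0 v) rv).
        by apply: scalar_form0; apply: fA1.1; rewrite rsz0.
      have e : A2 (L z0) ('d L z0 v) = A1 (rs z0) ('d rs z0 v).
        by apply/eqP; rewrite -subr_eq0; apply/eqP; exact: Cv.
      by rewrite A10 L0 in e; exact: e.
    by apply/rowP => j; rewrite ord1 !mxE -[RHS]bv.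
  by rewrite -[v]hsubmxK -[lsubmx v]/(ls v) -[rsubmx v]/(rs v) lsv rv row_mx0.
have [W3 [eta [oW3 seta W30 eta0 etaP]]] :=
  local_coordinates oB z0B sG (smooth_linear (ball z0 r) rs) Hinj.
(* The leading 0 is the prescribed value of [G], so [eta (ins x)] is the point of the hypersurface
   above [x]. *)
pose ins (x : 'rV[R]_m) : 'rV[R]_(1 + m) := row_mx 0 x.
have sins (O : set 'rV[R]_m) : open O -> smooth_on O ins.
  move=> oO j; apply: Ck_row_mx => //; first exact: Ck_cst.
  exact: (@smooth_linear _ _ _ O idfun j).
pose O3 : set 'rV[R]_m := [set: _] `&` ins @^-1` W3.
have oO3 : open O3.
  by apply: smooth_preimage_open => //; [exact: openT|exact: sins openT].
pose sig x := eta (ins x).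
have sigP x : O3 x -> [/\ ball z0 r (sig x), G (sig x) = 0 & rs (sig x) = x].
  move=> [_ /etaP[Bs Gs rss]]; split=> //.
    move/(congr1 (fun M : 'M[R]_1 => M 0 0)) : Gs.
    by rewrite row_mxKl !mxE eqxx mulr1n.
  by rewrite -/(sig x) in rss; rewrite rss row_mxKr.
have ssig : smooth_on O3 sig.
  by apply: (smooth_comp oO3 oW3 _ (sins _ oO3) seta) => x [].
have insx1 : ins x1 = row_mx (G z0)%:M (rs z0) by rewrite G0 rsz0 raddf0.
have O3x1 : O3 x1 by split=> //; rewrite /= insx1.
have sig1 : sig x1 = z0 by rewrite /sig insx1.
have sigO x : O3 x -> Oz (sig x) by move=> /sigP[/BO].
pose F x := L (sig x).
have sF : smooth_on O3 F by apply: (smooth_comp oO3 oOz sigO ssig sL).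
have FQ x : O3 x -> Q2 (F x) = Q1 x.
  by move=> Ox; rewrite /F LQ; [have [_ _ ->] := sigP x Ox|exact: sigO].
have dsig x : O3 x -> differentiable sig x by exact: smooth_diff.
have drs x v : O3 x -> rs ('d sig x v) = v.
  move=> Ox.
  have rsid y : O3 y -> (rs \o sig) y = y by move=> /sigP[].
  have drsx := linear_diff rs (sig x).
  refine (etrans (esym (diff_linear rs (sig x) ('d sig x v))) _).
  refine (etrans (esym (diff_chain v (dsig x Ox) drsx)) _).
  refine (etrans (diff_eq_on v oO3 Ox rsid (differentiable_comp (dsig x Ox) drsx)) _).
  exact: (@diff_linear _ _ _ idfun).
have FA x v : O3 x -> A2 (F x) ('d F x v) = A1 x v.
  move=> Ox; have [Bx _ rsx] := sigP x Ox; have Ozx := sigO x Ox.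
  have dF : 'd F x v = 'd L (sig x) ('d sig x v).
    exact: (diff_chain v (dsig x Ox) (dL _ Ozx)).
  (* Differentiating G = 0 along the section annihilates [C] on its tangent vectors, which is the
     equality of the two forms. *)
  have G0' y : O3 y -> (G \o sig) y = 0 by move=> /sigP[].
  have dGs := smooth_diff sG Bx.
  have : C (sig x) ('d sig x v) = 0.
    rewrite -dG//.
    refine (etrans (esym (diff_chain v (dsig x Ox) dGs)) _).
    refine (etrans (diff_eq_on v oO3 Ox G0' (differentiable_comp (dsig x Ox) dGs)) _).
    by rewrite diff_cst.
  move=> Cs.
  have e : A2 (L (sig x)) ('d L (sig x) ('d sig x v)) =
           A1 (rs (sig x)) ('d rs (sig x) ('d sig x v)).
    by apply/eqP; rewrite -subr_eq0; apply/eqP; exact: Cs.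
  rewrite dF; refine (etrans e _); rewrite rsx; congr (A1 _ _).
  by refine (etrans (diff_linear rs (sig x) ('d sig x v)) _); exact: drs.
(* A vector killed by dF is killed by [A1], through [FA], and by dQ1, through [FQ], so [inj1]
   applies. *)
have Finj v : 'd F x1 v = 0 -> v = 0.
  move=> Fv; apply: inj1.
    by rewrite -FA// Fv scalar_form0//; apply: fA2.1; rewrite /F sig1 L0.
  have dF1 := smooth_diff sF O3x1.
  have dQ2 : differentiable Q2 (F x1).
    by apply: smooth_diff sQ2 _; rewrite /F sig1 L0.
  refine (etrans (esym (diff_eq_on v oO3 O3x1 FQ (differentiable_comp dF1 dQ2))) _).
  by refine (etrans (diff_chain v dF1 dQ2) _); rewrite Fv linear0.
have [V [W [g [[oV Vx1 VO3 oW] [FV sg gK _]]]]] := inverse_function oO3 O3x1 sF Finj.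
exists V, W, F, g; split; first split=> //.
- by move=> x /VO3 /sigP[/BO/Oz1 + _ <-].
- by rewrite -FV => _ [x /VO3 /sigO /LO Lx <-].
split; first split=> //.
- exact: smooth_subset VO3 sF.
- by rewrite /F sig1 L0.
- by move=> x /VO3 Ox; split; [exact: FQ|move=> v; exact: FA].
Qed.

End Lift.

(** * Charts and tangent maps *)

Section Charts.
Context {R : realType}.

(** Each clause of [Ck] is a condition at single points, because ['D_v f] is the derivative of [f]
    on the whole space; the witness set may thus change with the point. *)
Lemma smooth_local (V W : normedModType R) (A : set V) (f : V -> W) :
  (forall x, A x -> exists B, B x /\ smooth_on B f) -> smooth_on A f.
Proof.
move=> loc k.
have {}loc x : A x -> exists B, B x /\ Ck k B f.
  by move=> /loc[B [Bx fB]]; exists B.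
elim: k f loc => [|k IH] f loc.
  by move=> x /loc[B [Bx]]; apply.
split=> [x /loc[B [Bx [df _]]]|v]; first exact: df.
by apply: IH => x /loc[B [Bx [_ Df]]]; exists B; split=> //; exact: Df.
Qed.

Lemma chart_image_open m (T : topologicalType) (c : chart R T m) (U : set T) :
  open U -> open (cfun c @` (cdom c `&` U)).
Proof.
move=> oU; rewrite openE => _ [p [cp Up] <-].
have cip : (cfun c @` cdom c) (cfun c p) by exists p.
have nU : nbhs (cinv c (cfun c p)) U by rewrite cfunK//; exact: open_nbhs_nbhs.
have := cinv_continuous cip nU.
have := open_nbhs_nbhs (conj (@cimg_open _ _ _ c) cip).
rewrite /interior; apply: filterS2 => x [q cq <-] /=.
by rewrite /= cfunK// => Uq; exists q.
Qed.

Lemma chart_preimage_open m (T : topologicalType) (c : chart R T m)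
  (V : set 'rV[R]_m) : open V -> open (cdom c `&` cfun c @^-1` V).
Proof.
move=> oV; rewrite openE => p [cp Vp]; apply: filterI.
  by apply: open_nbhs_nbhs; split=> //; exact: cdom_open.
by apply: (cfun_continuous cp); exact: open_nbhs_nbhs.
Qed.

Lemma continuous_preimage_open (T T' : topologicalType) (U : set T)
    (B : set T') (f : T -> T') : open U -> open B ->
  (forall p, U p -> {for p, continuous f}) -> open (U `&` f @^-1` B).
Proof.
move=> oU oB fc; rewrite openE => p [Up Bp]; apply: filterI.
  exact: open_nbhs_nbhs.
by apply: (fc p Up); exact: open_nbhs_nbhs.
Qed.

Definition transition {m} {T : topologicalType} (c c' : chart R T m) :=
  cfun c' \o cinv c.

(* The components at p of a tangent vector, from the chart c to the chart c'. *)
Definition coord_change {m} {T : topologicalType} (c c' : chart R T m) p :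
  'rV[R]_m -> 'rV[R]_m := 'd (transition c c') (cfun c p).

Lemma transitionE m (T : topologicalType) (c c' : chart R T m) p :
  cdom c p -> transition c c' (cfun c p) = cfun c' p.
Proof. by move=> cp; rewrite /transition /= cfunK. Qed.

Lemma transition_diff m (M : manifold R m) (c c' : chart R M m) p :
  atlas c -> atlas c' -> cdom c p -> cdom c' p ->
  differentiable (transition c c') (cfun c p).
Proof.
by move=> ac ac' cp c'p; apply: smooth_diff (atlas_compat ac ac') _; exists p.
Qed.

Lemma coord_change_id m (M : manifold R m) (c : chart R M m) p v :
  atlas c -> cdom c p -> coord_change c c p v = v.
Proof.
move=> ac cp.
have oO : open (cfun c @` (cdom c `&` setT)) by exact: chart_image_open openT.
have Op : (cfun c @` (cdom c `&` setT)) (cfun c p) by exists p.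
have e y : (cfun c @` (cdom c `&` setT)) y -> transition c c y = idfun y.
  by move=> [q [cq _] <-]; rewrite transitionE.
refine (etrans (diff_eq_on v oO Op e (transition_diff ac ac cp cp)) _).
exact: (@diff_linear _ _ _ idfun).
Qed.

Lemma coord_change_comp m (M : manifold R m) (c c' c'' : chart R M m) p v :
  atlas c -> atlas c' -> atlas c'' -> cdom c p -> cdom c' p -> cdom c'' p ->
  coord_change c' c'' p (coord_change c c' p v) = coord_change c c'' p v.
Proof.
move=> ac ac' ac'' cp c'p c''p.
have oO : open (cfun c @` (cdom c `&` cdom c')).
  exact: chart_image_open (@cdom_open _ _ _ c').
have Op : (cfun c @` (cdom c `&` cdom c')) (cfun c p) by exists p.
have e y : (cfun c @` (cdom c `&` cdom c')) y ->
    (transition c' c'' \o transition c c') y = transition c c'' y.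
  by move=> [q [cq c'q] <-]; rewrite /= !transitionE.
have d1 := transition_diff ac ac' cp c'p.
have d2 : differentiable (transition c' c'') (transition c c' (cfun c p)).
  by rewrite transitionE//; exact: transition_diff.
have -> : coord_change c' c'' p = 'd (transition c' c'') (transition c c' (cfun c p)).
  by rewrite transitionE.
refine (etrans (esym (diff_chain v d1 d2)) _).
exact: (diff_eq_on v oO Op e (differentiable_comp d1 d2)).
Qed.

Lemma coord_changeK m (M : manifold R m) (c c' : chart R M m) p v :
  atlas c -> atlas c' -> cdom c p -> cdom c' p ->
  coord_change c' c p (coord_change c c' p v) = v.
Proof. by move=> ac ac' cp c'p; rewrite coord_change_comp// coord_change_id. Qed.

End Charts.

(** * Smooth maps and tangent maps in fixed charts *)

Section Maps.
Context {R : realType}.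

Definition rep {m k} {M : manifold R m} {N : manifold R k} (f : M -> N)
  (c : chart R M m) (d : chart R N k) := cfun d \o f \o cinv c.

Section Two.
Context {m k : nat} {M : manifold R m} {N : manifold R k}.
Implicit Types (f : M -> N) (U : set M) (c : chart R M m) (d : chart R N k).

Lemma rep_diff f U c d p : smooth_map U f -> atlas c -> atlas d -> U p ->
  cdom c p -> cdom d (f p) -> differentiable (rep f c d) (cfun c p).
Proof.
by move=> [_ sf] ac ad Up cp dp; apply: smooth_diff (sf c d ac ad) _; exists p.
Qed.

Lemma repE f c d p : cdom c p -> rep f c d (cfun c p) = cfun d (f p).
Proof. by move=> cp; rewrite /rep /= cfunK. Qed.

Lemma rep_change f U c c' d d' p v : open U -> smooth_map U f ->
  atlas c -> atlas c' -> atlas d -> atlas d' -> U p ->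
  cdom c p -> cdom c' p -> cdom d (f p) -> cdom d' (f p) ->
  'd (rep f c' d') (cfun c' p) (coord_change c c' p v) =
  coord_change d d' (f p) ('d (rep f c d) (cfun c p) v).
Proof.
move=> oU sf ac ac' ad ad' Up cp c'p dp d'p.
pose B := cdom c' `&` (U `&` f @^-1` cdom d).
have oB : open B.
  apply: openI; first exact: cdom_open.
  by apply: continuous_preimage_open (@cdom_open _ _ _ d) sf.1.
have oO : open (cfun c @` (cdom c `&` B)) by exact: chart_image_open.
have Op : (cfun c @` (cdom c `&` B)) (cfun c p) by exists p.
have dc := transition_diff ac ac' cp c'p.
have dd := transition_diff ad ad' dp d'p.
have df := rep_diff sf ac ad Up cp dp.
have df' := rep_diff sf ac' ad' Up c'p d'p.
have ec := transitionE c' cp.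
have ef := repE f d cp.
rewrite /coord_change -ec in df' *; rewrite -ef in dd *.
refine (etrans (esym (diff_chain v dc df')) _).
refine (etrans _ (diff_chain v df dd)).
apply: (diff_eq_on v oO Op _ (differentiable_comp dc df')).
by move=> _ [q [cq [c'q [Uq dq]]] <-] /=; rewrite /rep /transition /= !cfunK.
Qed.

(** [tmap] uses the charts chosen at [p] and at [f p], which vary with [p]. This passes to two fixed
    charts, where calculus in row spaces applies. *)
Lemma tmap_rep f U c d p v : open U -> smooth_map U f ->
  atlas c -> atlas d -> U p -> cdom c p -> cdom d (f p) ->
  'd (rep f c d) (cfun c p) (coord_change (chart_at p) c p v) =
  coord_change (chart_at (f p)) d (f p) (tmap f p v).
Proof.
move=> oU sf ac ad Up cp dp; apply: (rep_change (U := U)) => //.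
- exact: chart_at_atlas.
- exact: chart_at_atlas.
- exact: chart_at_dom.
- exact: chart_at_dom.
Qed.

Lemma tmap_eq_on f g U p v : open U -> U p -> smooth_map U f ->
  (forall q, U q -> f q = g q) -> tmap f p v = tmap g p v.
Proof.
move=> oU Up sf fg; rewrite /tmap -(fg p Up).
have c0 := chart_at_dom p.
have oO : open (cfun (chart_at p) @` (cdom (chart_at p) `&` U)).
  exact: chart_image_open.
apply: (diff_eq_on v oO).
- by exists p.
- by move=> _ [q [cq Uq] <-] /=; rewrite cfunK// (fg q Uq).
- apply: (rep_diff sf) => //; [exact: chart_at_atlas..|exact: chart_at_dom].
Qed.

End Two.

Lemma smooth_map_comp m k l (M : manifold R m) (N : manifold R k)
    (K : manifold R l) (f : M -> N) (g : N -> K) U W :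
  open U -> open W -> smooth_map U f -> smooth_map W g ->
  smooth_map (U `&` f @^-1` W) (g \o f).
Proof.
move=> oU oW sf sg; split=> [p [Up Wfp]|c d ac ad].
  by apply: continuous_comp; [exact: sf.1|exact: sg.1].
(* The intermediate chart around [f p] depends on [p], so smoothness is checked near one point at a
   time. *)
apply: smooth_local => _ [p [[cp [Up Wp]] dp] <-].
pose e := chart_at (f p); have ae : atlas e by exact: chart_at_atlas.
have ep : cdom e (f p) by exact: chart_at_dom.
pose A := U `&` f @^-1` (cdom e `&` (W `&` g @^-1` cdom d)).
have oB : open (cdom e `&` (W `&` g @^-1` cdom d)).
  apply: openI; first exact: cdom_open.
  by apply: continuous_preimage_open (@cdom_open _ _ _ d) sg.1.
have oA : open A by apply: continuous_preimage_open oB sf.1.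
have oO := chart_image_open (c := c) oA; have oO' := chart_image_open (c := e) oB.
exists (cfun c @` (cdom c `&` A)); split; first by exists p.
apply: (@smooth_ext _ _ _ _ (rep g e d \o rep f c e)) => //.
  by move=> _ [q [cq [Uq [eq [Wq dq]]]] <-]; rewrite /rep /= !cfunK.
apply: (smooth_comp oO oO').
- move=> _ [q [cq [Uq Bq]] <-]; rewrite repE//; exists (f q) => //.
  by split=> //; case: Bq.
- by apply: smooth_subset (sf.2 c e ac ae) => _ [q [cq [Uq [eq _]]] <-]; exists q.
- apply: smooth_subset (sg.2 e d ae ad) => _ [q [_ [eq [Wq dq]]] <-].
  by exists q.
Qed.

Lemma tmap_comp m k l (M : manifold R m) (N : manifold R k)
    (K : manifold R l) (f : M -> N) (g : N -> K) U W p v :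
  open U -> open W -> smooth_map U f -> smooth_map W g -> U p -> W (f p) ->
  tmap (g \o f) p v = tmap g (f p) (tmap f p v).
Proof.
move=> oU oW sf sg Up Wp.
pose c := chart_at p; pose e := chart_at (f p); pose d := chart_at (g (f p)).
have cp : cdom c p by exact: chart_at_dom.
have ep : cdom e (f p) by exact: chart_at_dom.
have dp : cdom d (g (f p)) by exact: chart_at_dom.
have ac : atlas c by exact: chart_at_atlas.
have ae : atlas e by exact: chart_at_atlas.
have ad : atlas d by exact: chart_at_atlas.
pose A := U `&` f @^-1` (cdom e `&` W).
have oA : open A.
  by apply: continuous_preimage_open (openI (@cdom_open _ _ _ e) oW) sf.1.
have oO : open (cfun c @` (cdom c `&` A)) by exact: chart_image_open.
have Op : (cfun c @` (cdom c `&` A)) (cfun c p) by exists p.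
have df : differentiable (rep f c e) (cfun c p) by exact: (rep_diff sf).
have dg : differentiable (rep g e d) (rep f c e (cfun c p)).
  by rewrite repE//; exact: (rep_diff sg).
have -> : tmap g (f p) (tmap f p v) =
    'd (rep g e d) (rep f c e (cfun c p)) ('d (rep f c e) (cfun c p) v).
  by rewrite repE.
refine (etrans _ (diff_chain v df dg)).
apply/esym; apply: (diff_eq_on v oO Op _ (differentiable_comp df dg)).
by move=> _ [q [cq [Uq [eq Wq]]] <-]; rewrite /rep /= !cfunK.
Qed.

Lemma tmap_id m (M : manifold R m) (p : M) v : tmap (@idfun M) p v = v.
Proof. exact: coord_change_id (chart_at_atlas p) (chart_at_dom p). Qed.

Lemma smooth_map_subset m k (M : manifold R m) (N : manifold R k) (f : M -> N)
  U V : V `<=` U -> smooth_map U f -> smooth_map V f.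
Proof.
move=> VU [cf sf]; split=> [p /VU/cf //|c d ac ad].
apply: smooth_subset (sf c d ac ad) => _ [q [[cq /VU Uq] dq] <-].
by exists q.
Qed.

Lemma tmap_linear m k (M : manifold R m) (N : manifold R k) (f : M -> N) p a u v :
  tmap f p (a *: u + v) = a *: tmap f p u + tmap f p v.
Proof. by rewrite /tmap linearP. Qed.

Section Chart_maps.
Context {m k : nat} {M : manifold R m} {N : manifold R k}.
Variables (c1 : chart R M m) (c2 : chart R N k).
Hypotheses (ac1 : atlas c1) (ac2 : atlas c2).
Variables (V : set 'rV[R]_m) (F : 'rV[R]_m -> 'rV[R]_k).
Hypotheses (oV : open V) (sF : smooth_on V F).
Hypothesis FV : forall x, V x -> (cfun c2 @` cdom c2) (F x).

Definition chart_map : M -> N := cinv c2 \o F \o cfun c1.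

Lemma chart_map_dom p : V (cfun c1 p) -> cdom c2 (chart_map p).
Proof. by move=> /FV[q c2q e]; rewrite /chart_map /= -e cfunK. Qed.

Lemma chart_mapE p : V (cfun c1 p) -> cfun c2 (chart_map p) = F (cfun c1 p).
Proof. by move=> /FV[q c2q e]; rewrite /chart_map /= -e cfunK. Qed.

Lemma chart_map_continuous p : cdom c1 p -> V (cfun c1 p) ->
  {for p, continuous chart_map}.
Proof.
move=> cp Vp; apply: continuous_comp; first exact: cfun_continuous.
apply: continuous_comp; first exact: smooth_continuous sF Vp.
exact/cinv_continuous/FV.
Qed.

Lemma chart_map_smooth : smooth_map (cdom c1 `&` cfun c1 @^-1` V) chart_map.
Proof.
split=> [p [cp Vp]|c d ac ad].
  exact: chart_map_continuous.
have Vc : open (cdom c1 `&` cfun c1 @^-1` V) by exact: chart_preimage_open.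
have cc p : (cdom c1 `&` cfun c1 @^-1` V) p -> {for p, continuous chart_map}.
  by move=> [cp Vp]; exact: chart_map_continuous.
have oB : open ((cdom c1 `&` cfun c1 @^-1` V) `&` chart_map @^-1` cdom d).
  exact: continuous_preimage_open (@cdom_open _ _ _ d) cc.
rewrite -setIA; have oO := chart_image_open (c := c) oB.
have o2 : open (cfun c2 @` (cdom c2 `&` cdom d)).
  exact: chart_image_open (@cdom_open _ _ _ d).
(* In any other pair of charts the map is [F] between two transition maps. *)
apply: (@smooth_ext _ _ _ _
  (transition c2 d \o (F \o transition c c1))) => //.
apply: (smooth_comp oO o2).
- move=> _ [q [cq [[c1q Vq] dq]] <-]; rewrite /= transitionE//.
  by exists (chart_map q); [split=> //; exact: chart_map_dom|exact: chart_mapE].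
- apply: (smooth_comp oO oV) => //.
    by move=> _ [q [cq [[c1q Vq] dq]] <-]; rewrite transitionE.
  apply: smooth_subset (atlas_compat ac ac1).
  by move=> _ [q [cq [[c1q _] _]] <-]; exists q.
- exact: atlas_compat.
Qed.

Lemma tmap_chart_map p v : cdom c1 p -> V (cfun c1 p) ->
  'd F (cfun c1 p) (coord_change (chart_at p) c1 p v) =
  coord_change (chart_at (chart_map p)) c2 (chart_map p) (tmap chart_map p v).
Proof.
move=> cp Vp; have oU := chart_preimage_open c1 oV.
rewrite -(tmap_rep v oU chart_map_smooth ac1 ac2 (conj cp Vp) cp (chart_map_dom Vp)).
have oO := chart_image_open (c := c1) oU.
have Op : (cfun c1 @` (cdom c1 `&` (cdom c1 `&` cfun c1 @^-1` V))) (cfun c1 p).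
  by exists p.
apply: (diff_eq_on _ oO Op); last exact: smooth_diff sF Vp.
move=> _ [q [_ [c1q Vq]] <-]; rewrite repE//; exact/esym/chart_mapE.
Qed.

End Chart_maps.
End Maps.

(** * One-forms and their exterior derivative in an arbitrary chart *)

Section Forms_on_manifolds.
Context {R : realType} {m : nat} {M : manifold R m}.
Implicit Types (theta : M -> 'rV[R]_m -> R) (c : chart R M m).

Lemma form_in_cfun c theta p v : cdom c p ->
  form_in c theta (cfun c p) v = theta p (coord_change c (chart_at p) p v).
Proof. by move=> cp; rewrite /form_in /= cfunK. Qed.

Lemma form_in_coord_change c theta p v : atlas c -> cdom c p ->
  form_in c theta (cfun c p) (coord_change (chart_at p) c p v) = theta p v.
Proof.
move=> ac cp; rewrite form_in_cfun// coord_changeK//; first exact: chart_at_atlas.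
exact: chart_at_dom.
Qed.

Lemma one_form_form_in c theta U : atlas c -> smooth_form U theta ->
  one_form (cfun c @` (cdom c `&` U)) (form_in c theta).
Proof.
move=> ac [lt st]; split=> [_ [p [cp Up] <-] a u v|v]; last exact: st.
by rewrite /form_in/= cfunK// linearP; exact: lt.
Qed.

Lemma form_in_pullback c c' theta p v : atlas c -> atlas c' -> cdom c p ->
  cdom c' p -> form_in c' theta (cfun c' p) v =
    pullback (transition c' c) (form_in c theta) (cfun c' p) v.
Proof.
move=> ac ac' cp c'p; rewrite /pullback transitionE// !form_in_cfun//.
rewrite -/(coord_change c' c p v) coord_change_comp//; first exact: chart_at_atlas.
exact: chart_at_dom.
Qed.

Lemma dform_eq_on (O : set 'rV[R]_m) A B x v w : open O -> O x ->
  (forall y u, O y -> A y u = B y u) -> dform A x v w = dform B x v w.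
Proof.
move=> oO Ox AB; have nO := open_near oO Ox.
congr (_ - _); apply: near_eq_derive; apply: filterS nO => y /AB; exact.
Qed.

(** Chart independence of the exterior derivative: the local expressions are pullbacks of each other
    by the transition map, and [dform] commutes with pullback. *)
Lemma ext_d_chart c theta U p v w : open U -> smooth_form U theta -> U p ->
  atlas c -> cdom c p ->
  ext_d theta p v w = dform (form_in c theta) (cfun c p)
    (coord_change (chart_at p) c p v) (coord_change (chart_at p) c p w).
Proof.
move=> oU st Up ac cp; pose c0 := chart_at p.
have ac0 : atlas c0 by exact: chart_at_atlas.
have c0p : cdom c0 p by exact: chart_at_dom.
pose O := cfun c0 @` (cdom c0 `&` (cdom c `&` U)).
have oO : open O by apply: chart_image_open; apply: openI oU; exact: cdom_open.
have Op : O (cfun c0 p) by exists p.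
have oO' : open (cfun c @` (cdom c `&` U)) by exact: chart_image_open.
have OO' y : O y -> (cfun c @` (cdom c `&` U)) (transition c0 c y).
  by move=> [q [c0q [cq Uq]] <-]; rewrite transitionE//; exists q.
have sO : smooth_on O (transition c0 c).
  apply: smooth_subset (atlas_compat ac0 ac).
  by move=> _ [q [c0q [cq Uq]] <-]; exists q.
have e y u : O y -> form_in c0 theta y u =
    pullback (transition c0 c) (form_in c theta) y u.
  by move=> [q [c0q [cq Uq]] <-]; exact: form_in_pullback.
refine (etrans (dform_eq_on v w oO Op e) _).
rewrite (dform_pullback v w oO oO' OO' sO (one_form_form_in ac st) Op).
by rewrite transitionE.
Qed.

End Forms_on_manifolds.

(** * Reeb fields and the projection to the space of trajectories *)

Section Trajectories.
Context {R : realType}.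

(* The projection is constant along the trajectory through p, which exists
   because p lies on the same trajectory as itself. *)
Lemma tmap_trajectory m k (M : manifold R m) (N : manifold R k)
    (Z : M -> 'rV[R]_m) U (pi : M -> N) p :
  trajectory_space Z U pi -> U p -> tmap pi p (Z p) = 0.
Proof.
move=> [oU spi _ _ traj] Up.
have /(traj p p Up Up)[g [a [b [s [t [sI tI gs gt gU]]]]]] : pi p = pi p by [].
have [_ gc gd] := gU s sI; rewrite gs in gd.
pose c := chart_at p; pose d := chart_at (pi p).
have cp : cdom c p by exact: chart_at_dom.
have dp : cdom d (pi p) by exact: chart_at_dom.
have ac : atlas c by exact: chart_at_atlas.
have ad : atlas d by exact: chart_at_atlas.
have drep : differentiable (rep pi c d) (cfun c (g s)).
  by rewrite gs; exact: (rep_diff spi).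
pose kap (r : R) := cfun c (g r).
have dkap : differentiable kap s by apply/derivable1_diffP; case: gd.
have -> : Z p = 'd kap s 1 by rewrite -deriveE//; case: gd.
have -> : tmap pi p ('d kap s 1) = 'd (rep pi c d) (kap s) ('d kap s 1).
  by rewrite /tmap /kap gs.
refine (etrans (esym (diff_chain (1 : R) dkap drep)) _).
have nconst : \forall u \near s, (rep pi c d \o kap) u = cst (cfun d (pi p)) u.
  have nI : \forall u \near s, u \in `]a, b[%R.
    have : open `]a, b[%classic by exact: interval_open.
    by move/open_near; apply.
  have nc : \forall u \near s, cdom c (g u).
    by apply: gc; apply: open_nbhs_nbhs; split; [exact: cdom_open|rewrite gs].
  apply: filterS2 nI nc => u uI cu; rewrite /rep /kap /= cfunK//.
  have [Uu _ _] := gU u uI; congr (cfun d _); apply/esym/traj => //.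
  by exists g, a, b, s, u.
have [_ <-] := near_eq_diff nconst (differentiable_comp dkap drep).
by rewrite diff_cst.
Qed.

End Trajectories.

Section Structure.
Context {R : realType} {n : nat} {M : manifold R n.*2.+1} (S : contact_spr M).
Context (alpha : M -> tvec R n.*2.+1 -> R) (Z : M -> tvec R n.*2.+1).
Hypotheses (halpha : normalised_form S alpha) (hZ : reeb_field alpha Z).

Lemma alpha_scalar p : scalar (alpha p).
Proof. by have [[+ _] _ _] := halpha; apply. Qed.

Lemma alpha_reeb p : alpha p (Z p) = 1.
Proof. by have [_ _] := hZ; apply. Qed.

(** D has rank 2n and misses [Z p], because alpha is 1 there; together they span the tangent space,
    and applying alpha gives the coefficient of [Z p]. *)
Lemma reeb_decomposition p v :
  exists2 u, u \in dist S p & v = u + alpha p v *: Z p.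
Proof.
have [_ aD _] := halpha.
have [V [X [_ Vp [_ /(_ p Vp) bX]]]] := (dist_contact S).1 p.
have dimD : \dim (dist S p) = n.*2 by rewrite (size_basis bX).
have Zn : Z p \notin dist S p.
  by apply/negP => /aD/eqP; rewrite alpha_reeb oner_eq0.
have full : (dist S p + <[Z p]>)%VS = fullv.
  apply/eqP; rewrite eqEdim subvf /= dimvf /dim /=.
  rewrite dimv_disjoint_sum; last first.
    apply/eqP; rewrite -subv0; apply/subvP => w; rewrite memv_cap.
    move=> /andP[wD /vlineP[a wa]]; move: wD; rewrite wa.
    have [->|a0] := eqVneq a 0; first by move=> _; rewrite scale0r mem0v.
    move=> aZ; case/negP: Zn; rewrite -[Z p]scale1r -(mulVf a0) -scalerA.
    exact: memvZ.
  rewrite dimD dim_vline; have -> : Z p != 0.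
    by apply: contraNneq Zn => ->; exact: mem0v.
  by rewrite addn1 mul1n.
have : v \in (dist S p + <[Z p]>)%VS by rewrite full memvf.
move=> /memv_addP[u uD [w /vlineP[a ->] vE]]; exists u => //.
have al := alpha_scalar p.
by rewrite {2}vE (scalar_formD _ _ al) (scalar_formZ _ _ al) aD// alpha_reeb add0r mulr1.
Qed.

(** [normalised_form] only states that alpha vanishes on D; the decomposition supplies the converse
    inclusion. *)
Lemma mem_dist p v : v \in dist S p <-> alpha p v = 0.
Proof.
have [_ aD _] := halpha; split; first exact: aD.
by have [u uD {2}->] := reeb_decomposition p v => ->; rewrite scale0r addr0.
Qed.

Lemma form_ext_d p : exists O A x, [/\ open O, O x, one_form O A &
  forall v w, ext_d alpha p v w = dform A x v w].
Proof.
have [sa _ _] := halpha; pose c := chart_at p.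
exists (cfun c @` (cdom c `&` setT)), (form_in c alpha), (pt p); split=> //.
- exact: (chart_image_open (c := c) openT).
- by exists p => //; split=> //; exact: chart_at_dom.
- exact: one_form_form_in (chart_at_atlas p) sa.
Qed.

Lemma ext_d_reebD p u v a b :
  ext_d alpha p (u + a *: Z p) (v + b *: Z p) = ext_d alpha p u v.
Proof.
have [_ hr _] := hZ.
have [Q [A [x [oQ Qx fA e]]]] := form_ext_d p.
have li w := dform_lin1 w oQ Qx fA.
rewrite e (scalar_formD _ _ (li _)) (scalar_formZ _ _ (li _)) -[dform A x (Z p) _]e hr.
rewrite mulr0 addr0 dform_antisym (scalar_formD _ _ (li _)) (scalar_formZ _ _ (li _)).
by rewrite -[dform A x (Z p) _]e hr mulr0 addr0 -dform_antisym e.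
Qed.

Context {N : manifold R n.*2} {U : set M} {prj : M -> N}.
Hypothesis hpi : trajectory_space Z U prj.

Lemma tmap_reebD p u a : U p -> tmap prj p (u + a *: Z p) = tmap prj p u.
Proof.
by move=> Up; rewrite addrC tmap_linear (tmap_trajectory hpi)// scaler0 add0r.
Qed.

(** The hypothesis on [o] covers vectors of D only; it extends to all tangent vectors because
    neither side sees Reeb components. *)
Lemma ext_d_projection (o : N -> tvec R n.*2 -> tvec R n.*2 -> R) p v w :
  pulls_back_to (dist S) U prj (omega alpha) o -> U p ->
  ext_d alpha p v w = - o (prj p) (tmap prj p v) (tmap prj p w).
Proof.
move=> hpo Up.
have [v' v'D ->] := reeb_decomposition p v.
have [w' w'D ->] := reeb_decomposition p w.
by rewrite ext_d_reebD !tmap_reebD// hpo// /omega opprK.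
Qed.

End Structure.

(** A vector of D killed by the tangent map is [g]-orthogonal to all of D, hence zero by
    nondegeneracy. This serves both projections and [phi]. *)
Lemma pullback_metric_inj (R : realType) m k (M : manifold R m)
    (N : manifold R k) (D : M -> {vspace tvec R m}) U (f : M -> N) g g' p v :
  pseudo_metric D g -> pseudo_metric (@tangent R k N) g' ->
  pulls_back_to D U f g g' -> U p -> v \in D p -> tmap f p v = 0 -> v = 0.
Proof.
move=> [_ _ nd] [[gl _ _] _ _] fg Up vD v0; apply: (nd p v vD) => w wD.
(* Linearity at zero vectors gives y = y + y for the remaining value, so it vanishes. *)
rewrite -fg// v0.
have := gl (f p) 1 0 0 (tmap f p w) (memvf _) (memvf _) (memvf _).
by rewrite scaler0 addr0 mul1r; move: (g' _ _ _) => y; lra.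
Qed.

Lemma chart_image_mem (R : realType) m (T : topologicalType) (c : chart R T m) B p :
  cdom c p -> (cfun c @` (cdom c `&` B)) (cfun c p) -> B p.
Proof.
by move=> cp [q [cq Bq] e]; rewrite -(cfunK cp) -e cfunK.
Qed.

(** * Reduction of the theorem to charts and return to the manifolds *)

Theorem theorem4p2 (R : realType) (n : nat)
    (M1 M2 : manifold R n.*2.+1) (S1 : contact_spr M1) (S2 : contact_spr M2)
    (alpha1 : M1 -> tvec R n.*2.+1 -> R) (alpha2 : M2 -> tvec R n.*2.+1 -> R)
    (Z1 : M1 -> tvec R n.*2.+1) (Z2 : M2 -> tvec R n.*2.+1)
    (halpha1 : normalised_form S1 alpha1)
    (halpha2 : normalised_form S2 alpha2)
    (hZ1 : reeb_field alpha1 Z1) (hZ2 : reeb_field alpha2 Z2)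
    (* h_a = 0 *)
    (hh1 : vanishes (dist S1) (h_tensor Z1 (metric S1)))
    (hh2 : vanishes (dist S2) (h_tensor Z2 (metric S2)))
    (* the Lie derivative of omega_a along the Reeb field is 0 *)
    (homega1 : vanishes (dist S1) (lie_deriv Z1 (omega alpha1)))
    (homega2 : vanishes (dist S2) (lie_deriv Z2 (omega alpha2)))
    (* the local quotients *)
    (N1 N2 : manifold R n.*2) (U1 : set M1) (U2 : set M2)
    (pi1 : M1 -> N1) (pi2 : M2 -> N2)
    (hpi1 : trajectory_space Z1 U1 pi1) (hpi2 : trajectory_space Z2 U2 pi2)
    (* the projections of metric and omega *)
    (g1 : N1 -> tvec R n.*2 -> tvec R n.*2 -> R)
    (g2 : N2 -> tvec R n.*2 -> tvec R n.*2 -> R)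
    (o1 : N1 -> tvec R n.*2 -> tvec R n.*2 -> R)
    (o2 : N2 -> tvec R n.*2 -> tvec R n.*2 -> R)
    (hg1 : pseudo_metric (@tangent R n.*2 N1) g1)
    (hg2 : pseudo_metric (@tangent R n.*2 N2) g2)
    (ho1 : two_form (@tangent R n.*2 N1) o1)
    (ho2 : two_form (@tangent R n.*2 N2) o2)
    (hpg1 : pulls_back_to (dist S1) U1 pi1 (metric S1) g1)
    (hpg2 : pulls_back_to (dist S2) U2 pi2 (metric S2) g2)
    (hpo1 : pulls_back_to (dist S1) U1 pi1 (omega alpha1) o1)
    (hpo2 : pulls_back_to (dist S2) U2 pi2 (omega alpha2) o2)
    (* the local diffeomorphism of the quotients *)
    (p1 : N1) (p2 : N2) (W1 : set N1) (W2 : set N2) (phi : N1 -> N2)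
    (hW1 : W1 p1) (hphi : diffeo W1 W2 phi) (hphip : phi p1 = p2)
    (hphig : pulls_back_to (@tangent R n.*2 N1) W1 phi g1 g2)
    (hphio : pulls_back_to (@tangent R n.*2 N1) W1 phi o1 o2)
    (q1 : M1) (q2 : M2) (hq1 : U1 q1) (hq2 : U2 q2)
    (hpq1 : pi1 q1 = p1) (hpq2 : pi2 q2 = p2) :
  exists (V1 : set M1) (V2 : set M2) (F : M1 -> M2),
    [/\ V1 q1, diffeo V1 V2 F, F q1 = q2,
        (forall p, V1 p ->
           tmap F p @` [set v | v \in dist S1 p] =
           [set w | w \in dist S2 (F p)]) &
        pulls_back_to (dist S1) V1 F (metric S1) (metric S2)].

Proof.
have [oU1 spi1 _ _ _] := hpi1; have [oU2 spi2 _ _ _] := hpi2.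
have [oW1 _ _ sphi _] := hphi.
have [sa1 _ _] := halpha1; have [sa2 _ _] := halpha2.
(* Composing with [phi] makes both structures project to the same base [N2]. *)
pose f1 := phi \o pi1; pose U := U1 `&` pi1 @^-1` W1.
have oU : open U := continuous_preimage_open oU1 oW1 spi1.1.
have sf1 : smooth_map U f1 by exact: smooth_map_comp.
have tf1 p v : U p -> tmap f1 p v = tmap phi (pi1 p) (tmap pi1 p v).
  by move=> [Up Wp]; exact: tmap_comp oU1 oW1 spi1 sphi Up Wp.
have phi_inj y v : W1 y -> tmap phi y v = 0 -> v = 0.
  by move=> Wy; apply: (pullback_metric_inj hg1 hg2 hphig Wy); exact: memvf.
have inj1 p v : U p -> alpha1 p v = 0 -> tmap f1 p v = 0 -> v = 0.
  move=> Up /(mem_dist halpha1 hZ1) vD; rewrite tf1// => /(phi_inj _ _ Up.2).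
  exact: (pullback_metric_inj (metricP S1) hg1 hpg1 Up.1 vD).
have inj2 p v : U2 p -> alpha2 p v = 0 -> tmap pi2 p v = 0 -> v = 0.
  move=> Up /(mem_dist halpha2 hZ2) vD.
  exact: (pullback_metric_inj (metricP S2) hg2 hpg2 Up vD).
have star p p' v w v' w' : U p -> U2 p' -> f1 p = pi2 p' ->
    tmap f1 p v = tmap pi2 p' v' -> tmap f1 p w = tmap pi2 p' w' ->
    ext_d alpha1 p v w = ext_d alpha2 p' v' w'.
  move=> Up U2p e ev ew.
  rewrite (ext_d_projection halpha1 hZ1 hpi1 _ _ hpo1 Up.1).
  rewrite (ext_d_projection halpha2 hZ2 hpi2 _ _ hpo2 U2p).
  rewrite -(hphio _ _ _ Up.2 (memvf _) (memvf _)).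
  by rewrite -!tf1// ev ew -e.
(* A single chart [d2] of [N2] serves both projections, so that points and vectors below can be
   compared by their components. *)
pose c1 := chart_at q1; pose c2 := chart_at q2; pose d2 := chart_at p2.
have ac1 : atlas c1 := chart_at_atlas q1.
have ac2 : atlas c2 := chart_at_atlas q2.
have ad2 : atlas d2 := chart_at_atlas p2.
have c1q : cdom c1 q1 := chart_at_dom q1.
have c2q : cdom c2 q2 := chart_at_dom q2.
have d2p : cdom d2 p2 := chart_at_dom p2.
have Uq1 : U q1 by split=> //=; rewrite hpq1.
have f1q1 : f1 q1 = p2 by rewrite /f1 /= hpq1.
pose B1 := U `&` f1 @^-1` cdom d2; pose B2 := U2 `&` pi2 @^-1` cdom d2.
have oB1 : open B1 := continuous_preimage_open oU (@cdom_open _ _ _ d2) sf1.1.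
have oB2 : open B2 := continuous_preimage_open oU2 (@cdom_open _ _ _ d2) spi2.1.
pose O1 := cfun c1 @` (cdom c1 `&` B1); pose O2 := cfun c2 @` (cdom c2 `&` B2).
have oO1 : open O1 := chart_image_open oB1.
have oO2 : open O2 := chart_image_open oB2.
have O1q : O1 (cfun c1 q1).
  by exists q1 => //; split=> //; split=> //; rewrite /= f1q1.
have O2q : O2 (cfun c2 q2).
  by exists q2 => //; split=> //; split=> //; rewrite /= hpq2.
pose Q1 := rep f1 c1 d2; pose Q2 := rep pi2 c2 d2.
have sQ1 : smooth_on O1 Q1 by rewrite /O1 /B1 setIA; exact: sf1.2.
have sQ2 : smooth_on O2 Q2 by rewrite /O2 /B2 setIA; exact: spi2.2.
pose A1 := form_in c1 alpha1; pose A2 := form_in c2 alpha2.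
have fA1 : one_form O1 A1.
  apply: one_form_subset (one_form_form_in ac1 sa1) => _ [p [c1p _] <-].
  by exists p.
have fA2 : one_form O2 A2.
  apply: one_form_subset (one_form_form_in ac2 sa2) => _ [p [c2p _] <-].
  by exists p.
have Q12 : Q1 (cfun c1 q1) = Q2 (cfun c2 q2).
  by rewrite /Q1 /Q2 !repE// f1q1 hpq2.
have dQ1 p v : cdom c1 p -> B1 p ->
    'd Q1 (cfun c1 p) (coord_change (chart_at p) c1 p v) =
    coord_change (chart_at (f1 p)) d2 (f1 p) (tmap f1 p v).
  by move=> c1p [Up dp]; exact: (tmap_rep v oU sf1).
have dQ2 p v : cdom c2 p -> B2 p ->
    'd Q2 (cfun c2 p) (coord_change (chart_at p) c2 p v) =
    coord_change (chart_at (pi2 p)) d2 (pi2 p) (tmap pi2 p v).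
  by move=> c2p [Up dp]; exact: (tmap_rep v oU2 spi2).
have tinj y v w : cdom d2 y ->
    coord_change (chart_at y) d2 y v =
    coord_change (chart_at y) d2 y w -> v = w.
  move=> d2y /(congr1 (coord_change d2 (chart_at y) y)).
  have K u : coord_change d2 (chart_at y) y (coord_change (chart_at y) d2 y u) = u.
    by apply: coord_changeK => //; [exact: chart_at_atlas|exact: chart_at_dom].
  by rewrite !K.
have t0 y : coord_change (chart_at y) d2 y 0 = 0 by rewrite /coord_change linear0.
have inj1' v : A1 (cfun c1 q1) v = 0 -> 'd Q1 (cfun c1 q1) v = 0 -> v = 0.
  have -> : A1 (cfun c1 q1) v = alpha1 q1 v.
    by rewrite -[v in LHS](coord_change_id v ac1 c1q); exact: form_in_coord_change.
  have -> : 'd Q1 (cfun c1 q1) v =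
      coord_change (chart_at (f1 q1)) d2 (f1 q1) (tmap f1 q1 v).
    rewrite -[v in LHS](coord_change_id v ac1 c1q); apply: dQ1 => //.
    by split=> //; rewrite /= f1q1.
  rewrite -[in X in _ -> X -> _](t0 (f1 q1)) => av /tinj tv.
  by apply: inj1 av _ => //; apply: tv; rewrite f1q1.
have inj2' v : A2 (cfun c2 q2) v = 0 -> 'd Q2 (cfun c2 q2) v = 0 -> v = 0.
  have -> : A2 (cfun c2 q2) v = alpha2 q2 v.
    by rewrite -[v in LHS](coord_change_id v ac2 c2q); exact: form_in_coord_change.
  have -> : 'd Q2 (cfun c2 q2) v =
      coord_change (chart_at (pi2 q2)) d2 (pi2 q2) (tmap pi2 q2 v).
    rewrite -[v in LHS](coord_change_id v ac2 c2q); apply: dQ2 => //.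
    by split=> //; rewrite /= hpq2.
  rewrite -[in X in _ -> X -> _](t0 (pi2 q2)) => av /tinj tv.
  by apply: inj2 av _ => //; apply: tv; rewrite hpq2.
have star' x y v w v' w' : O1 x -> O2 y -> Q1 x = Q2 y ->
    'd Q1 x v = 'd Q2 y v' -> 'd Q1 x w = 'd Q2 y w' ->
    dform A1 x v w = dform A2 y v' w'.
  move=> [p [c1p B1p] <-] [p' [c2p' B2p'] <-].
  rewrite /Q1 /Q2 !repE// -/Q1 -/Q2 => e.
  (* Both images lie in the domain of [d2], so equal coordinates mean equal points. *)
  have {}e : f1 p = pi2 p' by rewrite -(cfunK B1p.2) e (cfunK B2p'.2).
  have lift1 u : u = coord_change (chart_at p) c1 p (coord_change c1 (chart_at p) p u).
    by rewrite coord_changeK//; [exact: chart_at_atlas|exact: chart_at_dom].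
  have lift2 u : u = coord_change (chart_at p') c2 p' (coord_change c2 (chart_at p') p' u).
    by rewrite coord_changeK//; [exact: chart_at_atlas|exact: chart_at_dom].
  have lift u u' : 'd Q1 (cfun c1 p) u = 'd Q2 (cfun c2 p') u' ->
      tmap f1 p (coord_change c1 (chart_at p) p u) =
      tmap pi2 p' (coord_change c2 (chart_at p') p' u').
    move=> eu; have a1 := dQ1 p (coord_change c1 (chart_at p) p u) c1p B1p.
    have a2 := dQ2 p' (coord_change c2 (chart_at p') p' u') c2p' B2p'.
    rewrite -lift1 e in a1; rewrite -lift2 in a2.
    exact: (tinj _ _ _ B2p'.2 (etrans (esym a1) (etrans eu a2))).
  move=> /lift ev /lift ew.
  have d1 := ext_d_chart (coord_change c1 (chart_at p) p v)
    (coord_change c1 (chart_at p) p w) openT sa1 I ac1 c1p.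
  have d2' := ext_d_chart (coord_change c2 (chart_at p') p' v')
    (coord_change c2 (chart_at p') p' w') openT sa2 I ac2 c2p'.
  rewrite -!lift1 in d1; rewrite -!lift2 in d2'.
  refine (etrans (esym d1) (etrans _ d2')).
  exact: (star _ _ _ _ _ _ B1p.1 B2p'.1 e ev ew).
(* Here [k] is [n.*2], and 1 + k is convertible to the dimension [n.*2.+1]. *)
have [V [W [F [G [[oV Vx VO oW WO] [[FV' sF sG GF Fx] FQA]]]]]] :=
  strict_contact_lift oO1 oO2 O1q O2q sQ1 sQ2 fA1 fA2 Q12 inj1' inj2' star'.
have FW x : V x -> W (F x) by move=> Vx'; rewrite -FV'; exists x.
have GW y : W y -> V (G y) /\ F (G y) = y.
  by rewrite -FV' => -[x Vx' <-]; rewrite GF.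
have FV x : V x -> (cfun c2 @` cdom c2) (F x).
  by move=> /FW/WO[p [c2p _] <-]; exists p.
have GV y : W y -> (cfun c1 @` cdom c1) (G y).
  by move=> /GW[/VO[p [c1p _] <-] _]; exists p.
pose Fm := chart_map c1 c2 F; pose Gm := chart_map c2 c1 G.
pose V1 := cdom c1 `&` cfun c1 @^-1` V; pose V2 := cdom c2 `&` cfun c2 @^-1` W.
have oV1 : open V1 := chart_preimage_open c1 oV.
have oV2 : open V2 := chart_preimage_open c2 oW.
have sFm : smooth_map V1 Fm := chart_map_smooth ac1 ac2 oV sF FV.
have sGm : smooth_map V2 Gm := chart_map_smooth ac2 ac1 oW sG GV.
have FmV p : V1 p -> V2 (Fm p).
  move=> [c1p Vp]; split; first exact: (chart_map_dom FV).
  by rewrite /= (chart_mapE FV)//; exact: FW.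
have GmV p : V2 p -> V1 (Gm p).
  move=> [c2p Wp]; split; first exact: (chart_map_dom GV).
  by rewrite /= (chart_mapE GV)//; have [] := GW _ Wp.
have GmK p : V1 p -> Gm (Fm p) = p.
  move=> [c1p Vp]; rewrite /Gm {1}/chart_map /= (chart_mapE FV)// GF//.
  exact: cfunK.
have FmK p : V2 p -> Fm (Gm p) = p.
  move=> [c2p Wp]; rewrite /Fm {1}/chart_map /= (chart_mapE GV)//.
  by have [_ ->] := GW _ Wp; exact: cfunK.
have B1V p : V1 p -> B1 p.
  by move=> [c1p /VO]; exact: chart_image_mem.
have B2V p : V2 p -> B2 p.
  by move=> [c2p /WO]; exact: chart_image_mem.
have pi2F p : V1 p -> pi2 (Fm p) = f1 p.
  move=> V1p; have [c2p Wp] := FmV p V1p; have [c1p Vp] := V1p.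
  have [+ _] := FQA _ Vp; rewrite -(chart_mapE FV Vp) /Q1 /Q2 !repE// => e.
  by rewrite -(cfunK (B2V _ (FmV p V1p)).2) e (cfunK (B1V _ V1p).2).
have alphaF p v : V1 p -> alpha2 (Fm p) (tmap Fm p v) = alpha1 p v.
  move=> V1p; have [c2p Wp] := FmV p V1p; have [c1p Vp] := V1p.
  have [_ FA] := FQA _ Vp.
  rewrite -(form_in_coord_change _ _ ac1 c1p) -/A1 -FA.
  rewrite (tmap_chart_map ac1 ac2 oV sF FV _ c1p Vp) -(chart_mapE FV Vp).
  by rewrite /A2 form_in_coord_change.
have tmapF p v : V1 p -> tmap pi2 (Fm p) (tmap Fm p v) = tmap f1 p v.
  move=> V1p; rewrite -(tmap_comp v oV1 oU2 sFm spi2 V1p (B2V _ (FmV _ V1p)).1).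
  apply: (tmap_eq_on v oV1 V1p _ pi2F).
  apply: smooth_map_subset (smooth_map_comp oV1 oU2 sFm spi2) => q V1q.
  by split=> //; have [] := B2V _ (FmV _ V1q).
have distF p v : V1 p -> v \in dist S1 p -> tmap Fm p v \in dist S2 (Fm p).
  move=> V1p /(mem_dist halpha1 hZ1) av; apply/(mem_dist halpha2 hZ2).
  by rewrite alphaF.
exists V1, V2, Fm; split.
- by split.
- split=> //.
    apply/seteqP; split=> [_ [p V1p <-]|p V2p]; first exact: FmV.
    by exists (Gm p); [exact: GmV|exact: FmK].
  by exists Gm.
- by rewrite /Fm /chart_map /= Fx cfunK.
- move=> p V1p; apply/seteqP; split=> [_ [v /= vD <-]|w /= wD]; first exact: distF.
  have V2p := FmV p V1p.
  (* The preimage of [w] is its image under the tangent map of the inverse; it lies in the first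
     distribution because [Fm] pulls alpha2 back to alpha1. *)
  have tFG : tmap Fm p (tmap Gm (Fm p) w) = w.
    have e := tmap_comp w oV2 oV1 sGm sFm V2p (GmV _ V2p).
    rewrite GmK// in e; rewrite -e.
    have smFG : smooth_map V2 (Fm \o Gm).
      apply: smooth_map_subset (smooth_map_comp oV2 oV1 sGm sFm) => q V2q.
      by split=> //; exact: GmV.
    by rewrite (tmap_eq_on (g := idfun) w oV2 V2p smFG FmK) tmap_id.
  exists (tmap Gm (Fm p) w) => //=.
  apply/(mem_dist halpha1 hZ1); rewrite -alphaF// tFG.
  exact/(mem_dist halpha2 hZ2).
- move=> p v w V1p vD wD.
  have [[[U1p W1p] _] [U2p _]] := (B1V p V1p, B2V _ (FmV p V1p)).
  (* Both arguments are pushed to [N2], where [pi2] after [Fm] is [phi] after [pi1]; the metric is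
     then pulled back through [phi] and [pi1]. *)
  rewrite -(hpg2 _ _ _ U2p (distF _ _ V1p vD) (distF _ _ V1p wD)) !tmapF// !tf1//.
  by rewrite pi2F// (hphig _ _ _ W1p (memvf _) (memvf _)) hpg1.
Qed.
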